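(* Let $m\in\mathbb{N}$, let $F=F(x,y)$ be a Finsler metric on $\mathbb{R}^{m+1}$, and let $X\in C^1(\mathscr{M},\mathbb{R}^{m+1})$ be an immersion from a smooth $m$-dimensional manifold $\mathscr{M}$ into $\mathbb{R}^{m+1}$. Then for every open subset $\Omega\subset\mathscr{M}$ with local coordinates $(u^1,\ldots,u^m):\Omega\to\tilde\Omega\subset\mathbb{R}^m$ the Finsler area satisfies $$\mathrm{area}^F_\Omega(X)=\int_{\tilde\Omega}\mathcal{A}^F\Big(X(u),\Big(\frac{\partial X}{\partial u^1}\wedge\ldots\wedge\frac{\partial X}{\partial u^m}\Big)(u)\Big)\,du^1\cdots du^m,$$ where $$\mathcal{A}^F(x,Z)=\frac{|Z|\,\mathscr{H}^m(B_1^m(0))}{\mathscr{H}^m(\{T\in Z^\perp\subset\mathbb{R}^{m+1}:F(x,T)\le 1\})}\quad\text{for }(x,Z)\in\mathbb{R}^{m+1}\times(\mathbb{R}^{m+1}\setminus\{0\}).$$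
   Context: A Finsler metric on $\mathbb{R}^{n}$ is a non-negative function $F=F(x,y)$, smooth on $\mathbb{R}^{n}\times(\mathbb{R}^{n}\setminus\{0\})$ (extended by $F(x,0)=0$), such that (F1) $F(x,ty)=tF(x,y)$ for all $t>0$; and (F2) the matrix $g_{ij}(x,y):=(F^2/2)_{y^iy^j}(x,y)$ is positive definite for all $x$ and all $y\neq0$. $\mathscr{H}^m$ is $m$-dimensional Hausdorff measure, $B_1^m(0)$ the unit ball of $\mathbb{R}^m$, and $Z^\perp:=\{T\in\mathbb{R}^{m+1}:T\cdot Z=0\}$. For $P_1,\dots,P_m\in\mathbb{R}^{m+1}$, $P_1\wedge\ldots\wedge P_m:=\sum_{i=1}^{m+1}\det(e_i|P_1|\ldots|P_m)\,e_i\in\mathbb{R}^{m+1}$. Finsler (Busemann–Hausdorff) area: for an immersion $X:\mathscr{M}\to\mathbb{R}^{m+1}$ the pulled-back metric is $(X^*F)(u,v):=F(X(u),dX|_u(v))$ for $(u,v)\in T\mathscr{M}$. In local coordinates the volume form is $d\mathrm{vol}_{X^*F}(u)=\sigma_{X^*F}(u)\,du^1\wedge\ldots\wedge du^m$ with $$\sigma_{X^*F}(u):=\frac{\mathscr{H}^m(B_1^m(0))}{\mathscr{H}^m(\{v=(v^1,\dots,v^m)\in\mathbb{R}^m: X^*F(u,\sum_{\delta=1}^m v^\delta\frac{\partial}{\partial u^\delta}|_u)\le1\})},$$ and $\mathrm{area}^F_\Omega(X):=\int_\Omega d\mathrm{vol}_{X^*F}$. *)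

(* Defs.v *)
From HB Require Import structures.
From mathcomp Require Import all_boot all_order all_algebra.
From mathcomp Require Import all_classical all_reals all_analysis.
Import Order.TTheory GRing.Theory Num.Theory.
Import numFieldNormedType.Exports.

Set Implicit Arguments.
Unset Strict Implicit.
Unset Printing Implicit Defensive.

Local Open Scope classical_set_scope.
Local Open Scope ring_scope.

(* The normed structure of MathComp-Analysis on ['rV[R]_n] is the sup norm,   *)
(* hence the separate Euclidean norm; topology and differentiability do not   *)
(* depend on the choice.                                                      *)
Definition dot (R : realType) (n : nat) (x y : 'rV[R]_n) : R :=
  \sum_(i < n) x 0 i * y 0 i.

Definition enorm (R : realType) (n : nat) (x : 'rV[R]_n) : R :=
  Num.sqrt (dot x x).

Definition evec (R : realType) (n : nat) (i : 'I_n) : 'rV[R]_n := delta_mx 0 i.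

Definition unit_ball (R : realType) (n : nat) : set 'rV[R]_n :=
  [set x | enorm x < 1].

Definition orthogonal_space (R : realType) (n : nat) (Z : 'rV[R]_n) :
  set 'rV[R]_n := [set T | dot T Z = 0].

Definition wedge (R : realType) (m : nat) (P : 'I_m -> 'rV[R]_m.+1) :
    'rV[R]_m.+1 :=
  \sum_(i < m.+1)
    \det ((col_mx (evec R i) (\matrix_(j < m) P j) : 'M[R]_(1 + m))^T)
      *: evec R i.

(* The cheapest countable covering of [A] by members of the family [S], [S i] *)
(* being charged [w i]; [None] stands for an unused slot, so that finite and  *)
(* empty coverings are allowed.                                               *)
Definition cover_outer (R : realType) (T I : Type) (S : I -> set T)
    (w : I -> \bar R) (A : set T) : \bar R :=
  ereal_inf [set \sum_(k <oo) oapp w 0%E (c k) | c in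
    [set c : nat -> option I | A `<=` \bigcup_k oapp S set0 (c k)]]%E.

Section cover_outer_theory.
Local Open Scope ereal_scope.
Context (R : realType) (T I : Type) (S : I -> set T) (w : I -> \bar R).
Hypothesis w_ge0 : forall i, 0 <= w i.

Local Notation mu := (cover_outer S w).
Let wo (o : option I) : \bar R := oapp w 0 o.
Let So (o : option I) : set T := oapp S set0 o.

Let wo_ge0 o : 0 <= wo o. Proof. by case: o => //=. Qed.

Lemma cover_outer_ge0 A : 0 <= mu A.
Proof.
apply: le_ereal_inf_tmp => _ [c _ <-].
by apply: nneseries_ge0 => n _ _; exact: wo_ge0.
Qed.

Lemma le_cover_outer : {homo mu : A B / A `<=` B >-> A <= B}.
Proof.
move=> A B AB; apply: ereal_inf_le_tmp => _ [c Bc <-].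
by exists c => //; exact: subset_trans Bc.
Qed.

Lemma cover_outer0 : mu set0 = 0.
Proof.
apply/eqP; rewrite eq_le cover_outer_ge0 andbT.
by apply: ereal_inf_lbound; exists (fun=> None) => //=; rewrite eseries0.
Qed.

Lemma cover_outer_sigma_subadditive : sigma_subadditive mu.
Proof.
move=> A; have [[i ioo]|] := pselect (exists i, mu (A i) = +oo).
  rewrite (eseries_pinfty _ _ ioo) ?leey// => n _.
  by rewrite -ltNye (lt_le_trans _ (cover_outer_ge0 _)).
rewrite -forallNE => Aoo.
apply/lee_addgt0Pr => e e0.
rewrite (le_trans _ (epsilon_trick _ _ (ltW e0)))//; last first.
  by move=> n; exact: cover_outer_ge0.
pose P n (c : nat -> option I) := A n `<=` \bigcup_k So (c k) /\
  \sum_(k <oo) wo (c k) <= mu (A n) + (e / (2 ^ n.+1)%:R)%:E.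
have [G PG] : {G : nat -> nat -> option I & forall n, P n (G n)}.
  apply: (@choice _ _ P) => n; rewrite /P.
  have en1 : (0 < e / (2 ^ n.+1)%:R)%R by rewrite divr_gt0// ltr0n expn_gt0.
  have fA : mu (A n) \is a fin_num.
    by rewrite ge0_fin_numE ?cover_outer_ge0// ltey; apply/eqP; exact: Aoo.
  have [x [c Ac <-] /ltW xlt] := lb_ereal_inf_adherent en1 fA.
  by exists c.
have wG_ge0 p : 0 <= (wo \o uncurry G) p by exact: wo_ge0.
apply: (@le_trans _ _ (\esum_(i in setT) (wo \o uncurry G) i)).
  apply: ereal_inf_lbound => /=.
  have /card_esym/ppcard_eqP[f] := card_nat2.
  exists (uncurry G \o f).
    move=> t [i _] /(PG i).1 [j _ ?].
    by exists (f^-1%FUN (i, j)) => //=; rewrite invK ?inE.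
  rewrite -(esum_pred_image (wo \o uncurry G) _ xpredT) ?[fun=> _]set_true//.
  by rewrite image_eq.
rewrite (_ : esum _ _ = \sum_(i <oo) \sum_(j <oo) wo (G i j)); last first.
  pose J : nat -> set (nat * nat) := fun i => [set (i, j) | j in setT].
  rewrite (_ : setT = \bigcup_k J k); last first.
    by rewrite predeqE => -[a b]; split => // _; exists a => //; exists b.
  rewrite esum_bigcupT /=; last 2 first.
    - apply/trivIsetP => i j _ _ ij.
      rewrite predeqE => -[n m] /=; split => //= -[] [_] _ [<-{n} _].
      by move=> [m' _] [] /esym/eqP; rewrite (negbTE ij).
    - by move=> /= [n m]; exact: wo_ge0.
  rewrite -(image_id [set: nat]) -fun_true esum_pred_image//; last first.
    by move=> n _; exact: esum_ge0.
  apply: eq_eseriesr => /= j _.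
  rewrite -(esum_pred_image (wo \o uncurry G) (pair j) predT)//=; last first.
    by move=> ? ? _ _; exact: (@can_inj _ _ _ snd).
  by congr esum; rewrite predeqE => -[a b]; split; move=> [i _ <-]; exists i.
apply: lee_lim.
- apply: is_cvg_nneseries => n *.
  by apply: nneseries_ge0 => m *; exact: (wG_ge0 (n, m)).
- apply: is_cvg_nneseries => n *; apply: adde_ge0 => //.
    exact: cover_outer_ge0.
  by rewrite lee_fin divr_ge0// ltW.
- by near=> n; apply: lee_sum => i _; exact: (PG i).2.
Unshelve. all: by end_near. Qed.

End cover_outer_theory.

Definition box (R : realType) (n : nat) (ab : 'rV[R]_n * 'rV[R]_n) :
  set 'rV[R]_n := [set x | forall i, ab.1 0 i <= x 0 i <= ab.2 0 i].

Definition box_volume (R : realType) (n : nat) (ab : 'rV[R]_n * 'rV[R]_n) :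
  \bar R := (\prod_(i < n) Num.max (ab.2 0 i - ab.1 0 i) 0)%:E.

Definition lebesgue_outer (R : realType) (n : nat) :
  set 'rV[R]_n -> \bar R := cover_outer (@box R n) (@box_volume R n).

Lemma box_volume_ge0 (R : realType) (n : nat) ab : (0 <= @box_volume R n ab)%E.
Proof.
by rewrite lee_fin prodr_ge0// => i _; rewrite le_max lexx orbT.
Qed.

HB.instance Definition _ (R : realType) (n : nat) :=
  isOuterMeasure.Build R 'rV[R]_n (@lebesgue_outer R n)
    (cover_outer0 (@box R n) (@box_volume_ge0 R n))
    (cover_outer_ge0 (@box R n) (@box_volume_ge0 R n))
    (@le_cover_outer _ _ _ (@box R n) (@box_volume R n))
    (cover_outer_sigma_subadditive (@box R n) (@box_volume_ge0 R n)).

Definition lebesgue_outer_measure (R : realType) (n : nat) :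
  {outer_measure set 'rV[R]_n -> \bar R} := @lebesgue_outer R n.

(* 'rV[R]_n with the sigma-algebra of Lebesgue measurable sets. *)
Definition lebesgue_space (R : realType) (n : nat) :=
  caratheodory_type (@lebesgue_outer_measure R n).

Definition lebesgue_measure_rV (R : realType) (n : nat) :
    {measure set (lebesgue_space R n) -> \bar R} :=
  (@lebesgue_outer_measure R n : set (lebesgue_space R n) -> \bar R).

Definition lebesgue_int (R : realType) (n : nat) (D : set 'rV[R]_n)
    (f : 'rV[R]_n -> \bar R) : \bar R :=
  (\int[lebesgue_measure_rV R n]_(u in (D : set (lebesgue_space R n))) f u)%E.

(* Volume of the Euclidean unit ball of R^m, by                               *)
(* omega_(m+2) = 2 pi / (m + 2) * omega_m.                                    *)
Fixpoint ball_volume (R : realType) (m : nat) : R :=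
  match m with
  | 0 => 1
  | 1 => 2
  | m'.+2 => 2 * pi / m%:R * ball_volume R m'
  end.

(* [-oo] on the empty set. *)
Definition diam (R : realType) (n : nat) (C : set 'rV[R]_n) : \bar R :=
  ereal_sup [set (enorm (p.1 - p.2))%:E | p in C `*` C].

Definition hausdorff_weight (R : realType) (n m : nat) (d : R)
    (C : {C : set 'rV[R]_n | C !=set0 /\ (diam C <= d%:E)%E}) : \bar R :=
  (ball_volume R m * (fine (diam (sval C)) / 2) ^+ m)%:E.

Definition hausdorff_measure (R : realType) (n m : nat) (A : set 'rV[R]_n) :
    \bar R :=
  ereal_sup [set cover_outer (fun C => sval C) (@hausdorff_weight R n m d) A
            | d in [set d : R | 0 < d]].

(* Meant for open [U]. *)
Fixpoint Ck (R : realType) (V W : normedModType R) (k : nat) (U : set V)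
    (f : V -> W) : Prop :=
  match k with
  | 0 => forall x, U x -> {for x, continuous f}
  | k'.+1 => (forall x, U x -> differentiable f x) /\
             forall v, Ck k' U (fun x => 'D_v f x)
  end.

Definition smooth_on (R : realType) (V W : normedModType R) (U : set V)
    (f : V -> W) : Prop := forall k, Ck k U f.

Record finsler_metric (R : realType) (n : nat)
    (F : 'rV[R]_n -> 'rV[R]_n -> R) : Prop := FinslerMetric {
  finsler_ge0 : forall x y, 0 <= F x y ;
  finsler_at0 : forall x, F x 0 = 0 ;
  finsler_smooth : smooth_on [set p : 'rV[R]_n * 'rV[R]_n | p.2 != 0]
    (fun p => F p.1 p.2 : R^o) ;
  finsler_homogeneous : forall x y t, 0 < t -> F x (t *: y) = t * F x y ;
  finsler_posdef : forall x y, y != 0 ->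
    let g i j := 'D_(evec R j)
      (fun z => 'D_(evec R i) (fun z' => F x z' ^+ 2 / 2 : R^o) z) y in
    forall w : 'rV[R]_n, w != 0 ->
      0 < \sum_(i < n) \sum_(j < n) g i j * w 0 i * w 0 j }.

(* [chart_map] and [chart_inv] are only meaningful on [chart_dom] and on the  *)
(* coordinate domain [chart_cod], respectively.                               *)
Record chart (R : realType) (M : Type) (m : nat) := Chart {
  chart_dom : set M ;
  chart_map : M -> 'rV[R]_m ;
  chart_inv : 'rV[R]_m -> M }.

Definition chart_cod (R : realType) (M : Type) (m : nat) (c : chart R M m) :
  set 'rV[R]_m := chart_map c @` chart_dom c.

Record is_chart (R : realType) (M : topologicalType) (m : nat)
    (c : chart R M m) : Prop := IsChart {
  chart_dom_open : open (chart_dom c) ;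
  chart_cod_open : open (chart_cod c) ;
  chart_mapK : forall p, chart_dom c p -> chart_inv c (chart_map c p) = p ;
  chart_map_continuous : forall p, chart_dom c p ->
    {for p, continuous (chart_map c)} ;
  chart_inv_continuous : forall u, chart_cod c u ->
    {for u, continuous (chart_inv c)} }.

Definition smooth_transition (R : realType) (M : Type) (m : nat)
    (c d : chart R M m) : Prop :=
  smooth_on (chart_map c @` (chart_dom c `&` chart_dom d))
    (chart_map d \o chart_inv c).

Definition compatible (R : realType) (M : Type) (m : nat)
    (c d : chart R M m) : Prop :=
  smooth_transition c d /\ smooth_transition d c.

(* [A] is the maximal atlas: it consists of all local coordinates. *)
Record smooth_manifold (R : realType) (M : topologicalType) (m : nat)
    (A : set (chart R M m)) : Prop := SmoothManifold {
  manifold_hausdorff : hausdorff_space M ;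
  manifold_second_countable : @second_countable M ;
  atlas_charts : forall c, A c -> is_chart c ;
  atlas_covers : forall p : M, exists2 c, A c & chart_dom c p ;
  atlas_compatible : forall c d, A c -> A d -> compatible c d ;
  atlas_maximal : forall c, is_chart c ->
    (forall d, A d -> compatible c d) -> A c }.

(* [tangent_map c X p v] is dX|_p applied to the tangent vector               *)
(* sum_delta v^delta d/du^delta|_p, u being the coordinates of [c].           *)
Definition tangent_map (R : realType) (M : Type) (m n : nat)
    (c : chart R M m) (X : M -> 'rV[R]_n) (p : M) (v : 'rV[R]_m) : 'rV[R]_n :=
  'd (X \o chart_inv c) (chart_map c p) v.

Definition C1_immersion (R : realType) (M : Type) (m n : nat)
    (A : set (chart R M m)) (X : M -> 'rV[R]_n) : Prop :=
  forall c, A c ->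
    Ck 1 (chart_cod c) (X \o chart_inv c) /\
    forall p, chart_dom c p -> injective (tangent_map c X p).

(* (X^*F)(p, sum_delta v^delta d/du^delta|_p) *)
Definition pullback_metric (R : realType) (M : Type) (m n : nat)
    (F : 'rV[R]_n -> 'rV[R]_n -> R) (X : M -> 'rV[R]_n) (c : chart R M m)
    (p : M) (v : 'rV[R]_m) : R := F (X p) (tangent_map c X p v).

Definition finsler_density (R : realType) (M : Type) (m n : nat)
    (F : 'rV[R]_n -> 'rV[R]_n -> R) (X : M -> 'rV[R]_n) (c : chart R M m)
    (p : M) : \bar R :=
  (hausdorff_measure m (@unit_ball R m) /
   hausdorff_measure m [set v : 'rV[R]_m | (pullback_metric F X c p v <= 1)%R])%E.

(* Integral over the coordinate domain [chart_dom c] of the volume form       *)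
(* [finsler_density F X c] du^1 /\ ... /\ du^m.                               *)
Definition finsler_area (R : realType) (M : Type) (m n : nat)
    (F : 'rV[R]_n -> 'rV[R]_n -> R) (X : M -> 'rV[R]_n) (c : chart R M m) :
    \bar R :=
  lebesgue_int (chart_cod c)
    (fun u => finsler_density F X c (chart_inv c u)).

Definition partial_derivative (R : realType) (M : Type) (m n : nat)
    (c : chart R M m) (X : M -> 'rV[R]_n) (u : 'rV[R]_m) (i : 'I_m) :
    'rV[R]_n := 'D_(evec R i) (X \o chart_inv c) u.

Definition finsler_integrand (R : realType) (m : nat)
    (F : 'rV[R]_m.+1 -> 'rV[R]_m.+1 -> R) (x Z : 'rV[R]_m.+1) : \bar R :=
  ((enorm Z)%:E * hausdorff_measure m (@unit_ball R m) /
   hausdorff_measure m (orthogonal_space Z `&` [set T | (F x T <= 1)%R]))%E.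

(* Main.v *)
From HB Require Import structures.
Require Import Defs.
From mathcomp Require Import all_boot all_order all_algebra.
From mathcomp Require Import all_classical all_reals all_analysis.
From mathcomp Require Import ring lra perm.
Import Order.TTheory GRing.Theory Num.Theory.
Import numFieldNormedType.Exports.

(* The two integrands agree pointwise. Write dX(v) = v J and let              *)
(* B = {v : F(x, v J) <= 1}, so that the set in the denominator of A^F is the *)
(* image B J; what has to be shown is H^m(B J) = |Z| H^m(B) with Z the wedge  *)
(* of the rows of J. The proof never identifies H^m with Lebesgue measure:    *)
(* two translation-invariant set functions, homogeneous of degree m and       *)
(* subadditive, have the same ratio on B as on the unit cube, because B is    *)
(* squeezed between a union of small grid cubes and a slight dilate of B.     *)
(* Hence S |-> H^m(Q S) / H^m(Q), for Q the cube, is a character of GL_m that *)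
(* equals s^m at the homothety of ratio s, and such a character is |det|.     *)
(* A reflection taking Z to an axis reduces the rectangular J to this case.   *)

Set Implicit Arguments.
Unset Strict Implicit.
Unset Printing Implicit Defensive.

Local Open Scope classical_set_scope.
Local Open Scope ring_scope.

(** * Hausdorff measure *)

(** The lemmas behind this outline are the following. [homogeneous_content_le] compares two
    homogeneous contents by counting grid cells. Applied in both directions to H^n and its pullback
    under a linear map, it yields [hausdorff_linear_image_cube], hence the multiplicativity that
    [homogeneous_character_det] turns into [hausdorff_linear_image], the change of variables for
    square matrices. [hausdorff_wedge] passes to m by m+1 matrices: the determinant with rows Z,
    P_1, ..., P_m is |Z|^2 by [dot_wedge], while an orthogonal map taking Z to |Z| e_0 splits it, up
    to sign, as |Z| times an m by m determinant, whose absolute value is therefore |Z|.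

    The comparison requires that a slight dilation of B absorb all small displacements of its
    points. This follows from compactness in [gauge_inflatable_bounded], once F is strictly positive
    off zero; [finsler_gt0] derives that from positive definiteness. By [wedge_orthogonal] the
    hyperplane orthogonal to Z is the range of dX, and the factor |Z| in the numerator of A^F
    cancels the one produced by the change of variables. *)

Section diameter.
Context {R : realType}.

Lemma dot_ge0 n (x : 'rV[R]_n) : 0 <= dot x x.
Proof. by apply: sumr_ge0 => i _; rewrite -expr2 sqr_ge0. Qed.

Lemma enorm_ge0 n (x : 'rV[R]_n) : 0 <= enorm x.
Proof. exact: sqrtr_ge0. Qed.

Lemma enorm_sqr n (x : 'rV[R]_n) : enorm x ^+ 2 = dot x x.
Proof. by rewrite sqr_sqrtr ?dot_ge0. Qed.

Lemma ball_volume_ge0 m : 0 <= ball_volume R m.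
Proof.
have [] : 0 <= ball_volume R m /\ 0 <= ball_volume R m.+1.
  elim: m => [|m [h0 h1]]; first by rewrite /= ler01 ler0n.
  by split=> //=; rewrite !mulr_ge0 ?pi_ge0 ?invr_ge0 ?ler0n.
by [].
Qed.

Lemma diam_le n (C : set 'rV[R]_n) (r : R) :
  (forall x y, C x -> C y -> enorm (x - y) <= r) -> (diam C <= r%:E)%E.
Proof.
move=> Cr; apply: ge_ereal_sup => _ [[x y] [/= Cx Cy] <-].
by rewrite lee_fin Cr.
Qed.

Lemma diam_ge n (C : set 'rV[R]_n) x y :
  C x -> C y -> ((enorm (x - y))%:E <= diam C)%E.
Proof. by move=> Cx Cy; apply: ereal_sup_ubound; exists (x, y). Qed.

Lemma diam_fineK n (C : set 'rV[R]_n) (d : R) :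
  C !=set0 -> (diam C <= d%:E)%E -> (fine (diam C))%:E = diam C.
Proof.
move=> [x Cx] Cd; rewrite fineK// ge0_fin_numE ?(le_lt_trans Cd) ?ltry//.
by apply: le_trans (diam_ge Cx Cx); rewrite lee_fin enorm_ge0.
Qed.

Lemma fine_diam_ge0 n (C : set 'rV[R]_n) (d : R) :
  C !=set0 -> (diam C <= d%:E)%E -> 0 <= fine (diam C).
Proof.
move=> C0 Cd; rewrite -lee_fin (diam_fineK C0 Cd); case: C0 => x Cx.
by apply: le_trans (diam_ge Cx Cx); rewrite lee_fin enorm_ge0.
Qed.

End diameter.

Section hausdorff.
Context {R : realType}.

Lemma hausdorff_weight_ge0 n m d C : (0 <= @hausdorff_weight R n m d C)%E.
Proof.
case: C => C [C0 Cd]; rewrite lee_fin mulr_ge0 ?ball_volume_ge0//.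
by rewrite exprn_ge0// divr_ge0//= (fine_diam_ge0 C0 Cd).
Qed.

Definition hausdorff_content n m (d : R) (A : set 'rV[R]_n) : \bar R :=
  cover_outer (fun C => sval C) (@hausdorff_weight R n m d) A.

HB.instance Definition _ n m (d : R) :=
  isOuterMeasure.Build R 'rV[R]_n (@hausdorff_content n m d)
    (cover_outer0 _ (@hausdorff_weight_ge0 n m d))
    (cover_outer_ge0 _ (@hausdorff_weight_ge0 n m d))
    (@le_cover_outer _ _ _ _ _)
    (cover_outer_sigma_subadditive _ (@hausdorff_weight_ge0 n m d)).

Lemma hausdorff_content_le n m (d : R) (A : set 'rV[R]_n) : 0 < d ->
  (hausdorff_content m d A <= hausdorff_measure m A)%E.
Proof. by move=> d0; apply: ereal_sup_ubound; exists d. Qed.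

Lemma hausdorff_measure_le n m (A : set 'rV[R]_n) x :
  (forall d, 0 < d -> (hausdorff_content m d A <= x)%E) ->
  (hausdorff_measure m A <= x)%E.
Proof. by move=> Ax; apply: ge_ereal_sup => _ [d d0 <-]; exact: Ax. Qed.

Lemma hausdorff_content_diam n m (d r : R) (A : set 'rV[R]_n) :
  0 <= r -> r <= d -> (forall x y, A x -> A y -> enorm (x - y) <= r) ->
  (hausdorff_content m d A <= (ball_volume R m * (r / 2) ^+ m)%:E)%E.
Proof.
move=> r0 rd Ar.
have b0 : 0 <= ball_volume R m * (r / 2) ^+ m.
  by rewrite mulr_ge0 ?ball_volume_ge0// exprn_ge0 ?divr_ge0.
have [->|A0] := eqVneq A set0; first by rewrite outer_measure0 lee_fin.
move/set0P: A0 => A0.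
have Ad : (diam A <= d%:E)%E.
  by apply: le_trans (diam_le Ar) _; rewrite lee_fin.
pose C : {C : set 'rV[R]_n | C !=set0 /\ (diam C <= d%:E)%E} :=
  exist _ A (conj A0 Ad).
apply: (@le_trans _ _ (hausdorff_weight m C)).
  apply: ereal_inf_lbound => /=.
  exists (fun k => if k == 0%N then Some C else None).
    by move=> x Ax; exists 0%N.
  rewrite (nneseries_split 0 1)//=; last first.
    by move=> k _; case: ifP => //= _; exact: hausdorff_weight_ge0.
  rewrite big_mkord big_ord1/= eseries0 ?adde0// => -[|k]//.
rewrite lee_fin ler_wpM2l ?ball_volume_ge0// lerXn2r ?nnegrE ?divr_ge0//.
  exact: fine_diam_ge0 A0 Ad.
rewrite ler_wpM2r// -lee_fin (diam_fineK A0 Ad); exact: diam_le.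
Qed.

(** The images of the pieces of a cover of [B] cover [A], and their diameters grow at most by the
    factor s, whence the change of size bound from d to s * d. *)
Lemma hausdorff_content_lipschitz a b m (h : 'rV[R]_b -> 'rV[R]_a) (s d : R)
    (A : set 'rV[R]_a) (B : set 'rV[R]_b) :
  0 < s -> A `<=` h @` B ->
  (forall x y, B x -> B y -> enorm (h x - h y) <= s * enorm (x - y)) ->
  (hausdorff_content m (s * d) A <= (s ^+ m)%:E * hausdorff_content m d B)%E.
Proof.
move=> s0 AB hB; rewrite muleC -lee_pdivrMr ?exprn_gt0//.
apply: le_ereal_inf_tmp => _ [c Bc <-].
rewrite lee_pdivrMr ?exprn_gt0// muleC.
have [c' c'P] : {c' : nat -> option {C : set 'rV[R]_a |
     C !=set0 /\ (diam C <= (s * d)%:E)%E} & forall k,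
   h @` (oapp (fun C => sval C) set0 (c k) `&` B)
     `<=` oapp (fun C => sval C) set0 (c' k) /\
   (oapp (@hausdorff_weight R _ m _) 0 (c' k) <=
    (s ^+ m)%:E * oapp (@hausdorff_weight R _ m _) 0 (c k))%E}.
  apply: (@choice _ _ (fun k o => h @` (oapp (fun C => sval C) set0 (c k) `&` B)
     `<=` oapp (fun C => sval C) set0 o /\
   (oapp (@hausdorff_weight R _ m _) 0 o <=
    (s ^+ m)%:E * oapp (@hausdorff_weight R _ m _) 0 (c k))%E)) => k.
  case: (c k) => [[C [C0 Cd]]|]/=; last first.
    by exists None; split=> /=; [move=> _ [x [[]]]|rewrite mule0].
  have [CB|/set0P CB] := eqVneq (C `&` B) set0.
    exists None; split=> /=; first by rewrite CB image_set0.
    apply: mule_ge0; first by rewrite lee_fin exprn_ge0// ltW.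
    exact: (hausdorff_weight_ge0 m (exist _ C (conj C0 Cd))).
  have hs : (diam (h @` (C `&` B)) <= (s * fine (diam C))%:E)%E.
    apply: diam_le => _ _ [x [Cx Bx] <-] [y [Cy By] <-].
    apply: le_trans (hB _ _ Bx By) _; rewrite ler_wpM2l ?(ltW s0)//.
    by rewrite -lee_fin (diam_fineK C0 Cd) diam_ge.
  have h0 : h @` (C `&` B) !=set0 by case: CB => x CBx; exists (h x), x.
  have hd : (diam (h @` (C `&` B)) <= (s * d)%:E)%E.
    apply: le_trans hs _; rewrite lee_fin ler_wpM2l ?(ltW s0)//.
    by rewrite -lee_fin (diam_fineK C0 Cd).
  pose hC : {C : set 'rV[R]_a | C !=set0 /\ (diam C <= (s * d)%:E)%E} :=
    exist _ (h @` (C `&` B)) (conj h0 hd).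
  exists (Some hC); split=> //=.
  rewrite lee_fin mulrCA ler_wpM2l ?ball_volume_ge0// -exprMn mulrA.
  have fd0 := fine_diam_ge0 h0 hd.
  have C'0 := fine_diam_ge0 C0 Cd.
  rewrite lerXn2r ?nnegrE ?divr_ge0 ?mulr_ge0 ?(ltW s0)//.
  by rewrite ler_wpM2r// -lee_fin (diam_fineK h0 hd).
have w0 k : (0 <= oapp (@hausdorff_weight R _ m _) 0 (c k))%E.
  by case: (c k) => //= C; exact: hausdorff_weight_ge0.
apply: (@le_trans _ _ (\sum_(k <oo) oapp (@hausdorff_weight R _ m _) 0 (c' k))%E).
  apply: ereal_inf_lbound => /=; exists c' => //.
  move=> _ /AB [x Bx <-]; have [k _ ckx] := Bc _ Bx.
  by exists k => //; apply: (c'P k).1; exists x.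
rewrite -nneseriesZl//; apply: lee_nneseries => k _; last exact: (c'P k).2.
by case: (c' k) => //= C _; exact: hausdorff_weight_ge0.
Qed.

Lemma hausdorff_lipschitz a b m (h : 'rV[R]_b -> 'rV[R]_a) (s : R)
    (A : set 'rV[R]_a) (B : set 'rV[R]_b) :
  0 < s -> A `<=` h @` B ->
  (forall x y, B x -> B y -> enorm (h x - h y) <= s * enorm (x - y)) ->
  (hausdorff_measure m A <= (s ^+ m)%:E * hausdorff_measure m B)%E.
Proof.
move=> s0 AB hB; apply: hausdorff_measure_le => d d0.
have -> : d = s * (d / s) by rewrite mulrC divfK ?gt_eqF.
apply: le_trans (hausdorff_content_lipschitz m _ s0 AB hB) _.
rewrite lee_pmul2l ?lte_fin ?exprn_gt0//.
by apply: hausdorff_content_le; rewrite divr_gt0.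
Qed.

Lemma hausdorff_measure0 n m : hausdorff_measure m (set0 : set 'rV[R]_n) = 0%E.
Proof.
apply/eqP; rewrite eq_le; apply/andP; split.
  by apply: hausdorff_measure_le => d d0; rewrite outer_measure0.
by apply: le_trans (hausdorff_content_le _ _ ltr01); rewrite outer_measure0.
Qed.

Lemma le_hausdorff_measure n m :
  {homo (@hausdorff_measure R n m) : A B / A `<=` B >-> (A <= B)%E}.
Proof.
move=> A B AB; apply: hausdorff_measure_le => d d0.
exact: le_trans (le_outer_measure _ _ _ AB) (hausdorff_content_le _ _ d0).
Qed.

Lemma hausdorff_measure_ge0 n m (A : set 'rV[R]_n) :
  (0 <= hausdorff_measure m A)%E.
Proof. by rewrite -(hausdorff_measure0 n m); exact: le_hausdorff_measure. Qed.

Lemma hausdorff_measureU n m (A B : set 'rV[R]_n) :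
  (hausdorff_measure m (A `|` B) <=
   hausdorff_measure m A + hausdorff_measure m B)%E.
Proof.
apply: hausdorff_measure_le => d d0.
apply: le_trans (outer_measureU2 _ _ _) _.
by apply: leeD; exact: hausdorff_content_le.
Qed.

End hausdorff.

(** * Translation-invariant homogeneous contents *)

Section homogeneous_measures.
Context {R : realType} {n : nat}.
Implicit Types (mu nu : set 'rV[R]_n -> \bar R) (A B : set 'rV[R]_n).

Definition cube (c : 'rV[R]_n) (r : R) : set 'rV[R]_n :=
  [set v | forall i, `|v 0 i - c 0 i| <= r].

(** What a grid argument uses: finite subadditivity in place of additivity, and a one-sided affine
    law, whose converse comes from the inverse dilation. *)
Record homogeneous_content mu : Prop := HomogeneousContent {
  hc_set0 : mu set0 = 0%E ;
  hc_le : {homo mu : A B / A `<=` B >-> (A <= B)%E} ;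
  hcU : forall A B, (mu (A `|` B) <= mu A + mu B)%E ;
  hc_affine : forall c (s : R) A, 0 < s ->
    (mu ((fun v => (c + s *: v)%R) @` A) <= (s ^+ n)%:E * mu A)%E ;
  hc_cube : (mu (cube 0%R 1%R) < +oo)%E }.

(** Centres of the N^n cells of half-side r / N that tile [cube 0 r]: odd multiples of the
    half-side, counted from the corner -r. *)
Definition grid_center (r : R) (N : nat) (k : {ffun 'I_n -> 'I_N}) : 'rV[R]_n :=
  \row_i (r / N%:R * (k i).*2.+1%:R - r).

Lemma cube_subset_grid (r : R) (N : nat) : 0 < r -> (0 < N)%N ->
  cube 0 r `<=`
  [set v | exists k : {ffun 'I_n -> 'I_N}, cube (grid_center r k) (r / N%:R) v].
Proof.
move=> r0 N0 v vr /=.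
have Nr : 0 < N%:R :> R by rewrite ltr0n.
pose t i := (v 0 i + r) / (2 * (r / N%:R)).
have rN : 0 < r / N%:R by rewrite divr_gt0.
have vb i : - r <= v 0 i <= r by have := vr i; rewrite mxE subr0 ler_norml.
have t0 i : 0 <= t i.
  by rewrite divr_ge0 ?mulr_ge0 ?(ltW rN)//; have := vb i; lra.
(* The cap at N - 1 puts the face v_i = r, where t i = N, into the last cell. *)
have lt1 i : (minn (Num.trunc (t i)) N.-1 < N)%N.
  by rewrite -[X in (_ < X)%N](prednK N0) ltnS geq_minr.
exists [ffun i => Ordinal (lt1 i)] => i.
rewrite !mxE ffunE/=.
have vE : v 0 i = t i * (2 * (r / N%:R)) - r.
  by rewrite /t divfK ?addrK// mulf_neq0// ?gt_eqF.
set k := minn _ _.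
suff [kt tk] : k%:R <= t i /\ t i <= k%:R + 1.
  have -> : k.*2.+1%:R = 2 * k%:R + 1 :> R by rewrite -muln2 -natr1 natrM mulrC.
  rewrite vE ler_norml.
  by apply/andP; split; rewrite -subr_ge0; nra.
have /andP[l1 l2] := truncn_itv (t0 i).
rewrite /k; have [le|lt] := leqP (Num.trunc (t i)) N.-1.
  by rewrite natr1 l1 ltW.
split; first by apply: le_trans l1; rewrite ler_nat ltnW.
rewrite natr1 prednK// /t ler_pdivrMr ?mulr_gt0 ?invr_gt0//.
have -> : N%:R * (2 * (r / N%:R)) = 2 * r by field; rewrite gt_eqF.
by have := vb i; lra.
Qed.

Section facts.
Variable mu : set 'rV[R]_n -> \bar R.
Hypothesis hmu : homogeneous_content mu.

Lemma hc_ge0 A : (0 <= mu A)%E.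
Proof. by rewrite -(hc_set0 hmu); apply: (hc_le hmu). Qed.

Lemma hc_scale A (s : R) : 0 < s ->
  (mu ((fun v => s *: v) @` A) <= (s ^+ n)%:E * mu A)%E.
Proof.
move=> s0; apply: le_trans (hc_affine hmu 0 A s0).
by apply: (hc_le hmu) => _ [v Av <-]; exists v => //; rewrite add0r.
Qed.

Lemma hc_cube_le c (s : R) : 0 < s -> (mu (cube c s) <= (s ^+ n)%:E * mu (cube 0 1))%E.
Proof.
move=> s0; apply: le_trans (hc_affine hmu c (cube 0 1) s0).
apply: (hc_le hmu) => v vc; exists (s^-1 *: (v - c)).
  move=> i; rewrite !mxE subr0 normrM gtr0_norm ?invr_gt0//.
  by rewrite mulrC ler_pdivrMr// mul1r.
by rewrite scalerA divff ?gt_eqF// scale1r addrC subrK.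
Qed.

Lemma hc_cube_fin : mu (cube 0 1) \is a fin_num.
Proof. by rewrite ge0_fin_numE ?hc_ge0// (hc_cube hmu). Qed.

Lemma hc_cube_scale (s : R) : 0 < s ->
  mu (cube 0 s) = ((s ^+ n)%:E * mu (cube 0 1)%R)%E.
Proof.
move=> s0; apply/eqP; rewrite eq_le hc_cube_le//=.
rewrite muleC -lee_pdivlMr ?exprn_gt0// muleC -exprVn.
apply: le_trans (hc_affine hmu 0 _ _); rewrite ?invr_gt0//.
apply: (hc_le hmu) => v v1; exists (s *: v); last first.
  by rewrite add0r scalerA mulVf ?gt_eqF// scale1r.
move=> i; have := v1 i; rewrite !mxE !subr0 normrM gtr0_norm// => vi.
by rewrite ler_piMr// ltW.
Qed.

Lemma hc_bigcup (I : finType) (P : pred I) (F : I -> set 'rV[R]_n) (x : \bar R) :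
  (forall i, P i -> (mu (F i) <= x)%E) ->
  (mu [set v | exists2 i, P i & F i v] <= \sum_(i | P i) x)%E.
Proof.
move=> Fx.
have -> : [set v | exists2 i, P i & F i v] = \big[setU/set0]_(i | P i) F i.
  apply/seteqP; split => v /=.
    by move=> [i Pi Fiv]; rewrite (bigD1 i)//=; left.
  elim/big_rec: _ => //= i A Pi IH [Fv|/IH//]; by exists i.
elim/big_rec2: _ => [|i A y Pi IH]; first by rewrite (hc_set0 hmu).
by apply: le_trans (hcU hmu _ _) _; apply: leeD => //; exact: Fx.
Qed.

(* The cells outside [K] cover the rest of the cube, so subadditivity alone   *)
(* also bounds the union of the cells of [K] from below.                      *)
Lemma hc_grid_le (r : R) (N : nat) (K : pred {ffun 'I_n -> 'I_N}) A :
  0 < r -> (0 < N)%N ->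
  (forall k v, K k -> cube (grid_center r k) (r / N%:R) v -> A v) ->
  ((#|K|%:R * (r / N%:R) ^+ n)%:E * mu (cube 0 1) <= mu A)%E.
Proof.
move=> r0 N0 KA.
have s0 : 0 < r / N%:R by rewrite divr_gt0// ltr0n.
have fin := hc_cube_fin; rewrite -(fineK fin).
set q := fine _; set s := r / N%:R.
have cov : cube 0 r `<=` A `|` [set v | exists2 k, ~~ K k & cube (grid_center r k) s v].
  move=> v /(cube_subset_grid r0 N0)[k kv].
  by have [Kk|nKk] := boolP (K k); [left; exact: KA kv|right; exists k].
have := le_trans (hc_le hmu cov) (hcU hmu _ _).
rewrite hc_cube_scale// -(fineK fin) -/q.
have /leeD2l lec := @hc_bigcup _ (fun k => ~~ K k) (fun k => cube (grid_center r k) s)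
  ((s ^+ n)%:E * mu (cube 0 1)) (fun k _ => @hc_cube_le (grid_center r k) s s0).
move=> /le_trans/(_ (lec _)) {lec cov}.
rewrite -(fineK fin) -/q -EFinM sumEFin sumr_const -EFinM.
have cK : (#|fun k => ~~ K k|%:R = N%:R ^+ n - #|K|%:R :> R).
  have := cardC K; rewrite card_ffun !card_ord => cK.
  by rewrite -natrX -cK natrD addrAC subrr add0r.
case: (mu A) (hc_ge0 A) => [a| |//] _; last by move=> _; exact: leey.
rewrite -EFinD !lee_fin => H0.
have H : r ^+ n * q <= a + s ^+ n * q * (N%:R ^+ n - #|K|%:R).
  by rewrite -cK mulr_natr; exact: H0.
(* The large cube is worth N^n cells and the complement of [K] at most N^n - #|K| of them, so
   subtraction leaves #|K| cells for [A]. *)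
have rN : r ^+ n = N%:R ^+ n * (r / N%:R) ^+ n.
  by rewrite -exprMn mulrCA divff ?mulr1// pnatr_eq0 -lt0n.
move: H; rewrite rN -/s; set X := _ ^+ n; set Y := _ ^+ n; set c := _%:R => H.
lra.
Qed.

End facts.

(* Makes the grid cells that meet [A] stay inside a slight dilate of [A].     *)
Definition inflatable A := forall e : R, 0 < e -> exists2 d : R, 0 < d &
  forall v w : 'rV[R]_n, A v -> (forall i, `|w 0 i - v 0 i| <= d) ->
  exists2 a, A a & w = (1 + e) *: a.

Definition inflatable_bounded A :=
  (exists2 r : R, 0 < r & A `<=` cube 0 r) /\ inflatable A.

(** Convexity: on [0, 1] the power lies below its chord from 1 to 2^k. *)
Lemma expr1D_le (e : R) k : 0 <= e <= 1 -> (1 + e) ^+ k <= 1 + (2 ^+ k - 1) * e.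
Proof.
move=> /andP[e0 e1]; elim: k => [|k IH].
  by rewrite !expr0 subrr mul0r addr0.
rewrite exprSr; apply: le_trans (ler_wpM2r _ IH) _; first by lra.
have k1 : 1 <= 2 ^+ k :> R by rewrite exprn_ege1// ler1n.
have : 0 <= (2 ^+ k - 1) * e * (1 - e) by rewrite !mulr_ge0 ?subr_ge0.
by rewrite exprS; lra.
Qed.

(** The grid cells meeting [A] cover [A], which bounds nu A from above; they also lie in (1 + e) A,
    which bounds (1 + e)^n mu A from below by the same number of cells. Then e tends to 0. Products
    instead of quotients allow for a null cube. *)
Lemma homogeneous_content_le mu nu A :
  homogeneous_content mu -> homogeneous_content nu -> inflatable_bounded A ->
  (mu (cube 0 1) * nu A <= nu (cube 0 1) * mu A)%E.
Proof.
move=> hmu hnu [[r r0 Ar] infA].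
have fmA : mu A \is a fin_num.
  rewrite ge0_fin_numE ?(hc_ge0 hmu)//; apply: le_lt_trans (hc_le hmu Ar) _.
  by rewrite (hc_cube_scale hmu)// -(fineK (hc_cube_fin hmu)) -EFinM ltry.
rewrite -(fineK fmA) -(fineK (hc_cube_fin hmu)) -(fineK (hc_cube_fin hnu)).
set p := fine (mu (cube _ _)); set q := fine (nu _); set a := fine (mu A).
have p0 : 0 <= p by rewrite fine_ge0// hc_ge0.
have q0 : 0 <= q by rewrite fine_ge0// hc_ge0.
have a0 : 0 <= a by rewrite fine_ge0// hc_ge0.
have main e : 0 < e -> (p%:E * nu A <= (q * ((1 + e) ^+ n * a))%:E)%E.
  move=> e0; have [d d0 dA] := infA e e0.
  (* Two points of one cell differ by at most 2 r / N in each coordinate; this N makes that at most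
     d. *)
  pose N := (Num.trunc (r * 2 / d)).+1.
  have N0 : (0 < N)%N by [].
  have Nr : 0 < N%:R :> R by rewrite ltr0n.
  have Nd : r / N%:R * 2 <= d.
    rewrite mulrAC ler_pdivrMr// [d * _]mulrC -ler_pdivrMr//.
    by apply/ltW; exact: truncnS_gt.
  have s0 : 0 < r / N%:R by rewrite divr_gt0.
  pose K (k : {ffun 'I_n -> 'I_N}) :=
    `[< exists2 v, A v & cube (grid_center r k) (r / N%:R) v >].
  set t := 1 + e; have t0 : 0 < t by rewrite addr_gt0.
  have lo : ((#|K|%:R * (r / N%:R) ^+ n * p)%:E <= (t ^+ n * a)%:E)%E.
    rewrite (EFinM _ p) (EFinM _ a) (fineK fmA) (fineK (hc_cube_fin hmu)).
    apply: le_trans (hc_scale hmu A t0).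
    apply: (hc_grid_le hmu r0 N0) => k w /asboolP[v Av kv] kw.
    have wv i : `|w 0 i - v 0 i| <= d.
      apply: le_trans Nd; have := kv i; have := kw i.
      by rewrite !ler_norml; lra.
    by have [x Ax ->] := dA v w Av wv; exists x.
  have up : (nu A <= (#|K|%:R * (r / N%:R) ^+ n * q)%:E)%E.
    have Acov : A `<=` [set v | exists2 k, K k &
        cube (grid_center r k) (r / N%:R) v].
      move=> v Av; have [k kv] := cube_subset_grid r0 N0 (Ar _ Av).
      by exists k => //; apply/asboolP; exists v.
    apply: le_trans (hc_le hnu Acov) _.
    apply: le_trans (hc_bigcup hnu (fun k _ => hc_cube_le hnu (grid_center r k) s0)) _.
    rewrite -(fineK (hc_cube_fin hnu)) -/q -EFinM sumEFin sumr_const.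
    by rewrite lee_fin -[X in X <= _]mulr_natl mulrA.
  apply: le_trans (lee_wpmul2l _ up) _; first by rewrite lee_fin.
  rewrite -EFinM lee_fin; rewrite lee_fin in lo.
  have := ler_wpM2l q0 lo; congr (_ <= _); ring.
have fnA : nu A \is a fin_num.
  rewrite ge0_fin_numE ?(hc_ge0 hnu)//; apply: le_lt_trans (hc_le hnu Ar) _.
  by rewrite (hc_cube_scale hnu)// -(fineK (hc_cube_fin hnu)) -EFinM ltry.
rewrite -(fineK fnA) in main *; set b := fine _ in main *.
rewrite -!EFinM; apply/lee_addgt0Pr => e e0.
(* Used with e / C as dilation parameter: the summand e gives e / C <= 1, as [expr1D_le] requires,
   and the first summand keeps the error 2^n q a (e / C) below e. *)
pose C := 2 ^+ n * q * a + e + 1.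
have D0 : 0 <= 2 ^+ n * q * a by rewrite !mulr_ge0// exprn_ge0.
have C0 : 0 < C by rewrite /C; lra.
have h0 : 0 < e / C by rewrite divr_gt0.
have := main _ h0; rewrite -EFinM -EFinD !lee_fin => /le_trans; apply.
have h1 : e / C <= 1 by rewrite ler_pdivrMr// mul1r /C; lra.
have Dh : 2 ^+ n * q * a * (e / C) <= e.
  by rewrite mulrCA ler_piMr ?(ltW e0)// ler_pdivrMr// mul1r /C; lra.
have := @expr1D_le (e / C) n; rewrite (ltW h0) h1 => /(_ isT) E1.
have /(ler_wpM2l q0) : (1 + e / C) ^+ n * a <= (1 + 2 ^+ n * (e / C)) * a.
  by rewrite ler_wpM2r// (le_trans E1)// lerD2l ler_wpM2r ?(ltW h0)// gerBl.
move=> /le_trans; apply.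
by move: Dh; set h := e / C; set X := 2 ^+ n; lra.
Qed.
End homogeneous_measures.

(** * Characters of the general linear group *)

Section determinant_character.
Context {R : realType}.

(** Gaussian elimination in blocks 1 + n: multiplicativity forces the value 1 on block
    transvections, and the lower right block falls under the induction hypothesis. *)
Lemma character_det n (c : 'M[R]_n -> R) :
  (forall S T, S \in unitmx -> T \in unitmx -> c (S *m T) = c S * c T) ->
  c 1%:M = 1 ->
  (forall i s, s != 0 -> c (diag_mx (\row_j if j == i then s else 1)) = `|s|) ->
  forall S, S \in unitmx -> c S = `|\det S|.
Proof.
elim: n c => [|n IH] c cM c1 cd S Su.
  by rewrite det_mx00 normr1 -c1; congr c; apply/matrixP => -[].
rewrite -[n.+1]/(1 + n)%N in c cM c1 cd S Su *.
have c_neq0 T : T \in unitmx -> c T != 0.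
  move=> Tu; apply/eqP => cT0; have := cM T (invmx T) Tu.
  rewrite unitmx_inv mulmxV// c1 cT0 mul0r => /(_ Tu) /eqP.
  by rewrite oner_eq0.
pose U b : 'M[R]_(1 + n) := block_mx 1%:M b 0 1%:M.
pose V b : 'M[R]_(1 + n) := block_mx 1%:M 0 b 1%:M.
pose D (a : R) : 'M[R]_(1 + n) := block_mx a%:M 0 0 1%:M.
have detU b : \det (U b) = 1 by rewrite det_ublock !det1 mulr1.
have detV b : \det (V b) = 1 by rewrite det_lblock !det1 mulr1.
have detD a : \det (D a) = a by rewrite det_ublock det1 mulr1 det_scalar1.
have unitU b : U b \in unitmx by rewrite unitmxE detU unitr1.
have unitV b : V b \in unitmx by rewrite unitmxE detV unitr1.
have unitD a : a != 0 -> D a \in unitmx by rewrite unitmxE detD unitfE.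
have two0 : 2 != 0 :> R by rewrite pnatr_eq0.
(* Conjugation by [D 2] turns [U b] into its square, and [V b] by [D 2]^-1. *)
have cU b : c (U b) = 1.
  have := congr1 c (_ : D 2 *m U b = U b *m (U b *m D 2)).
  have uUD : U b *m D 2 \in unitmx by rewrite unitmx_mul unitU unitD.
  rewrite !cM ?unitD// => H.
  apply/(mulIf (mulf_neq0 (c_neq0 _ (unitU b)) (c_neq0 _ (unitD _ two0)))).
  rewrite -H ?mul1r; first by rewrite mulrC.
  rewrite /D /U !mulmx_block !(mul1mx, mulmx1, mulmx0, mul0mx, addr0, add0r).
  by congr block_mx; rewrite mul_scalar_mx scaler_nat mulr2n.
have cV b : c (V b) = 1.
  have := congr1 c (_ : V b *m D 2 = D 2 *m (V b *m V b)).
  have uVV : V b *m V b \in unitmx by rewrite unitmx_mul unitV.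
  rewrite !cM ?unitD// => H.
  apply/(mulfI (mulf_neq0 (c_neq0 _ (unitD _ two0)) (c_neq0 _ (unitV b)))).
  rewrite mulr1 -mulrA -H; first by rewrite mulrC.
  rewrite /D /V !mulmx_block !(mul1mx, mulmx1, mulmx0, mul0mx, addr0, add0r).
  by congr block_mx; rewrite mul_mx_scalar scaler_nat mulr2n.
have diagE n' (d : 'I_n' -> R) :
    diag_mx (\row_j d j) = \matrix_(i, j) (d i *+ (i == j)) :> 'M[R]_n'.
  by apply/matrixP => i j; rewrite !mxE.
have cD a : a != 0 -> c (D a) = `|a|.
  move=> a0; rewrite -(cd (lshift n 0) _ a0) /D; congr c; rewrite diagE.
  apply/matrixP => i j; rewrite [RHS]mxE.
  case: (split_ordP i) => k ->; case: (split_ordP j) => l ->.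
  - by rewrite block_mxEul mxE !ord1 !eqxx.
  - by rewrite block_mxEur mxE eq_lrshift.
  - by rewrite block_mxEdl mxE !eq_rlshift.
  - by rewrite block_mxEdr mxE eq_rlshift (inj_eq (@rshift_inj _ _)).
pose c' (T : 'M[R]_n) := c (block_mx (1%:M : 'M[R]_1) 0 0 T).
have unitB T : (block_mx (1%:M : 'M[R]_1) 0 0 T \in unitmx) = (T \in unitmx).
  by rewrite !unitmxE det_ublock det1 mul1r.
have c'E T : T \in unitmx -> c' T = `|\det T|.
  apply: IH => [S' T' Su' Tu'||i s s0].
  - rewrite /c' -cM ?unitB//; congr c.
    by rewrite mulmx_block !mulmx0 !mul0mx !addr0 add0r mulmx1.
  - by rewrite /c' -scalar_mx_block c1.
  - rewrite -(cd (rshift 1 i) _ s0) /c'; congr c; rewrite !diagE.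
    apply/matrixP => k l; rewrite [RHS]mxE.
    case: (split_ordP k) => {}k ->; case: (split_ordP l) => {}l ->.
    + by rewrite block_mxEul mxE eq_lrshift (inj_eq (@lshift_inj _ _)).
    + by rewrite block_mxEur mxE !eq_lrshift.
    + by rewrite block_mxEdl mxE eq_rlshift.
    + by rewrite block_mxEdr mxE !(inj_eq (@rshift_inj _ _)).
(* A nonzero corner [a] gives a lower-diagonal-upper factorization through the Schur complement of
   [a]. *)
have cS (T : 'M[R]_(1 + n)) : T \in unitmx -> T 0 0 != 0 -> c T = `|\det T|.
  move=> Tu a0; set a := T 0 0 in a0.
  have TE : T = V (a^-1 *: dlsubmx T) *m (D a *m
      (block_mx (1%:M : 'M[R]_1) 0 0 (drsubmx T - a^-1 *: (dlsubmx T *m ursubmx T))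
       *m U (a^-1 *: ursubmx T))).
    have ulE : ulsubmx T = a%:M.
      by apply/matrixP => i j; rewrite !ord1 !mxE eqxx mulr1n; congr (T _ _); apply/val_inj.
    rewrite -[LHS]submxK ulE /V /D /U !mulmx_block.
    rewrite !(mul1mx, mulmx1, mulmx0, mul0mx, addr0, add0r).
    rewrite mul_mx_scalar mul_scalar_mx !scalerA !mulfV// !scale1r.
    by rewrite -scalemxAl addrC subrK.
  have := Tu; rewrite {1}TE !unitmx_mul unitB => /and4P[_ _ Ru _].
  rewrite TE !cM ?unitmx_mul ?unitV ?unitU ?(unitD _ a0) ?unitB ?Ru// cV cU (cD _ a0).
  rewrite mul1r mulr1 -/(c' _) c'E// !det_mulmx detV detU detD mul1r mulr1.
  by rewrite det_ublock det1 mul1r normrM.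
have [S0|S0] := eqVneq (S 0 0) 0; last exact: cS.
have [k Sk] : exists k, dlsubmx S k 0 != 0.
  apply/existsP; rewrite -[X in is_true X]negbK negb_exists.
  apply/negP => /forallP dl0; move: Su; rewrite -[S]submxK.
  have -> : dlsubmx S = 0.
    by apply/matrixP => i j; have /negPn/eqP := dl0 i; rewrite !ord1 => ->; rewrite mxE.
  have -> : ulsubmx S = 0.
    by apply/matrixP => i j; rewrite !ord1 !mxE -[RHS]S0; congr (S _ _); apply/val_inj.
  by rewrite unitmxE det_ublock det0 mul0r unitr0.
(* Adding row [k] of the lower block to the top row makes the corner nonzero and changes neither [c]
   nor the determinant. *)
have := cS (U (delta_mx 0 k) *m S).
rewrite unitmx_mul unitU Su cM// cU mul1r det_mulmx detU mul1r => -> //.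
rewrite -[S]submxK /U mulmx_block !mul1mx.
have -> : 0 = lshift n 0 :> 'I_(1 + n) by apply/val_inj.
rewrite block_mxEul mxE.
have -> : ulsubmx S 0 0 = 0.
  by rewrite !mxE -[RHS]S0; congr (S _ _); apply/val_inj.
by rewrite add0r -rowE mxE.
Qed.

(** Diagonal matrices with a single entry s and ones elsewhere are conjugate under transpositions,
    so they share one value; n of them multiply to [s%:M], and for s > 0 nonnegativity makes the
    n-th root unique. *)
Lemma homogeneous_character_det n (c : 'M[R]_n -> R) :
  (forall S T, S \in unitmx -> T \in unitmx -> c (S *m T) = c S * c T) ->
  (forall S, 0 <= c S) ->
  (forall s, 0 < s -> c s%:M = s ^+ n) ->
  forall S, S \in unitmx -> c S = `|\det S|.
Proof.
move=> cM c_ge0 cs.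
have c1 : c 1%:M = 1 by rewrite cs ?expr1n.
apply: character_det => // i.
pose dg (r : seq 'I_n) (s : R) : 'M[R]_n := diag_mx (\row_j if j \in r then s else 1).
have dgu r s : s != 0 -> dg r s \in unitmx.
  move=> s0; rewrite unitmxE det_diag unitfE prodf_seq_neq0; apply/allP => j _ /=.
  by rewrite mxE; case: ifP => // _; rewrite oner_eq0.
have dgE j s : diag_mx (\row_k if k == j then s else 1) = dg [:: j] s.
  by congr diag_mx; apply/rowP => k; rewrite !mxE inE.
have perm j s : s != 0 -> c (dg [:: j] s) = c (dg [:: i] s).
  move=> s0; pose t : 'M[R]_n := tperm_mx i j.
  have tu : t \in unitmx by exact: unitmx_perm.
  have ct : c t * c t = 1.
    by rewrite -cM// -perm_mxM tperm2 perm_mx1.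
  rewrite -[RHS]mul1r -ct mulrAC -!cM ?unitmx_mul ?tu ?dgu//; congr c.
  rewrite -row_permE /t -[X in _ *m perm_mx X]tpermV -col_permE.
  apply/matrixP => a b; rewrite !mxE !inE (inj_eq perm_inj).
  congr (_ *+ _); congr (if _ then _ else _).
  by rewrite -(inj_eq (@perm_inj _ (tperm i j)) a j) tpermR.
have pos s : 0 < s -> c (dg [:: i] s) = s.
  move=> s0; have s0' : s != 0 by rewrite gt_eqF.
  have prod r : uniq r -> c (dg r s) = c (dg [:: i] s) ^+ size r.
    elim: r => [_|j r IH /= /andP[jr ur]].
      rewrite expr0 -[RHS]c1; congr c; apply/matrixP => a b.
      by rewrite !mxE in_nil.
    rewrite exprS -IH// -(perm j)// -cM ?dgu//; congr c.
    rewrite mulmx_diag; congr diag_mx; apply/rowP => k; rewrite !mxE !inE.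
    have [->|_] := eqVneq k j; first by rewrite (negbTE jr) mulr1.
    by rewrite mul1r.
  have := prod _ (enum_uniq 'I_n).
  have -> : dg (enum 'I_n) s = s%:M.
    by apply/matrixP => a b; rewrite !mxE mem_enum.
  rewrite cs// size_enum_ord => /esym/eqP; rewrite eqrXn2 ?(ltW s0)//.
    by move=> /eqP.
  by case: (n) (i) => // -[].
(* A possibly negative s is reduced to s^2 > 0 by squaring the matrix; nonnegativity of [c] selects
   the root. *)
move=> s s0; rewrite dgE; apply/eqP; rewrite -(@eqrXn2 _ 2)//.
rewrite expr2 -cM ?dgu// -normrX ger0_norm ?sqr_ge0//.
have -> : dg [:: i] s *m dg [:: i] s = dg [:: i] (s ^+ 2).
  rewrite mulmx_diag; congr diag_mx; apply/rowP => k; rewrite !mxE.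
  by case: ifP => _; rewrite ?mulr1.
by rewrite pos// lt_neqAle sqr_ge0 eq_sym expf_neq0.
Qed.

End determinant_character.

(** * Linear images *)

Section linear_images.
Context {R : realType}.

(** A crude upper bound for the operator norm with respect to the sup norms. *)
Definition mx_sum n p (J : 'M[R]_(n, p)) : R := \sum_i \sum_j `|J i j|.

Lemma mx_sum_ge0 n p (J : 'M[R]_(n, p)) : 0 <= mx_sum J.
Proof. by apply: sumr_ge0 => i _; apply: sumr_ge0. Qed.

Lemma mulmx_coord_le n p (J : 'M[R]_(n, p)) (v : 'rV[R]_n) r :
  0 <= r -> (forall i, `|v 0 i| <= r) -> forall j, `|(v *m J) 0 j| <= r * mx_sum J.
Proof.
move=> r0 vr j; rewrite mxE mulr_sumr.
apply: le_trans (ler_norm_sum _ _ _) _; apply: ler_sum => i _.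
rewrite normrM; apply: le_trans (ler_wpM2r _ (vr i)) _ => //.
rewrite ler_wpM2l// (bigD1 j)//= lerDl; exact: sumr_ge0.
Qed.

Lemma coord_le_enorm n (v : 'rV[R]_n) i : `|v 0 i| <= enorm v.
Proof.
rewrite -sqrtr_sqr ler_wsqrtr// /dot (bigD1 i)//= expr2 lerDl.
by apply: sumr_ge0 => j _; rewrite -expr2 sqr_ge0.
Qed.

Lemma enorm_le_coord n (v : 'rV[R]_n) r :
  0 <= r -> (forall i, `|v 0 i| <= r) -> enorm v <= Num.sqrt n%:R * r.
Proof.
move=> r0 vr; rewrite -[X in _ * X](ger0_norm r0) -sqrtr_sqr -sqrtrM ?ler0n//.
rewrite ler_wsqrtr// mulr_natl -[n in _ *+ n]card_ord -sumr_const.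
by apply: ler_sum => i _; rewrite -expr2 -real_normK ?num_real// lerXn2r ?nnegrE.
Qed.

Lemma enorm_mulmx_le n p (J : 'M[R]_(n, p)) :
  exists2 C : R, 0 < C & forall v, enorm (v *m J) <= C * enorm v.
Proof.
exists (Num.sqrt p%:R * mx_sum J + 1) => [|v].
  by rewrite ltr_wpDl// mulr_ge0 ?sqrtr_ge0 ?mx_sum_ge0.
have r0 : 0 <= enorm v * mx_sum J by rewrite mulr_ge0 ?enorm_ge0 ?mx_sum_ge0.
have := enorm_le_coord r0 (mulmx_coord_le J (enorm_ge0 v) (@coord_le_enorm _ v)).
move=> /le_trans; apply.
by rewrite mulrDl mul1r -mulrA [mx_sum J * _]mulrC lerDl enorm_ge0.
Qed.

Lemma enormZ n (s : R) (v : 'rV[R]_n) : enorm (s *: v) = `|s| * enorm v.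
Proof.
rewrite /enorm -sqrtr_sqr -sqrtrM ?sqr_ge0//; congr Num.sqrt.
by rewrite /dot mulr_sumr; apply: eq_bigr => i _; rewrite !mxE; ring.
Qed.

Definition linear_image n p (J : 'M[R]_(n, p)) (A : set 'rV[R]_n) :=
  (fun v => v *m J) @` A.

Lemma linear_image_mul n p q (J : 'M[R]_(n, p)) (K : 'M[R]_(p, q)) A :
  linear_image (J *m K) A = linear_image K (linear_image J A).
Proof.
apply/seteqP; split => [_ [v Av <-]|_ [_ [v Av <-] <-]].
  by exists (v *m J); [exists v|rewrite mulmxA].
by exists v => //; rewrite mulmxA.
Qed.

Lemma linear_image1 n A : linear_image (1%:M : 'M[R]_n) A = A.
Proof.
apply/seteqP; split => [_ [v Av <-]|v Av]; first by rewrite mulmx1.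
by exists v => //; rewrite mulmx1.
Qed.

Lemma hausdorff_linear_image_le n p m (J : 'M[R]_(n, p)) :
  exists2 C : R, 0 < C & forall A, (hausdorff_measure m (linear_image J A) <=
    C%:E * hausdorff_measure m A)%E.
Proof.
have [C C0 CJ] := enorm_mulmx_le J.
exists (C ^+ m); first by rewrite exprn_gt0.
move=> A; apply: (hausdorff_lipschitz (h := fun v => v *m J) _ C0) => // x y _ _.
by rewrite -mulmxBl CJ.
Qed.

Lemma hausdorff_isometry n p m (J : 'M[R]_(n, p)) A :
  (forall v, enorm (v *m J) = enorm v) ->
  hausdorff_measure m (linear_image J A) = hausdorff_measure m A.
Proof.
move=> JI; apply/eqP; rewrite eq_le; apply/andP; split.
  rewrite -[leRHS]mul1e -(expr1n _ m).
  apply: (hausdorff_lipschitz (h := fun v => v *m J) _ ltr01) => // x y _ _.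
  by rewrite -mulmxBl JI mul1r.
have Jinj : injective (fun v : 'rV[R]_n => v *m J).
  move=> x y /eqP; rewrite -subr_eq0 -mulmxBl => /eqP xy0.
  apply/eqP; rewrite -subr_eq0; apply/eqP/rowP => i; rewrite [RHS]mxE.
  apply/eqP; rewrite -normr_le0; apply: le_trans (coord_le_enorm _ _) _.
  by rewrite -JI xy0 /enorm /dot big1 ?sqrtr0// => j _; rewrite mxE mul0r.
(* A left inverse, arbitrary off the range of [J], is 1-Lipschitz on the image of [A]; this gives
   the reverse inequality. *)
have [h hK] : exists h, cancel (fun v : 'rV[R]_n => v *m J) h.
  have /choice[h hP] : forall w : 'rV[R]_p, exists v : 'rV[R]_n,
      forall v', w = v' *m J -> v = v'.
    move=> w; have [[v vw]|nv] := pselect (exists v : 'rV[R]_n, w = v *m J).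
      by exists v => v'; rewrite vw => /Jinj.
    by exists 0 => v' v'w; case: nv; exists v'.
  by exists h => v; exact: hP.
rewrite -[leRHS]mul1e -(expr1n _ m).
apply: (hausdorff_lipschitz (h := h) _ ltr01) => [v Av|_ _ [x Ax <-] [y Ay <-]].
  by exists (v *m J) => //; exists v.
by rewrite !hK -mulmxBl JI mul1r.
Qed.

(** The cube splits into N^n cells of diameter at most 2 sqrt(n) / N, whose total weight [b] does
    not depend on N. *)
Lemma hausdorff_cube_lty n : (hausdorff_measure n (cube (0 : 'rV[R]_n) 1) < +oo)%E.
Proof.
pose b : R := ball_volume R n * Num.sqrt n%:R ^+ n.
apply: (@le_lt_trans _ _ b%:E); last exact: ltry.
apply: hausdorff_measure_le => d d0.
pose N := (Num.trunc (Num.sqrt n%:R * 2 / d)).+1.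
have N0 : (0 < N)%N by [].
have Nr : 0 < N%:R :> R by rewrite ltr0n.
have Nd : Num.sqrt n%:R * (2 / N%:R) <= d.
  rewrite mulrA ler_pdivrMr// [d * _]mulrC -ler_pdivrMr//.
  by apply/ltW; exact: truncnS_gt.
have s0 : 0 <= Num.sqrt n%:R * (2 / N%:R) :> R.
  by rewrite mulr_ge0 ?sqrtr_ge0// divr_ge0 ?(ltW Nr).
apply: le_trans (le_outer_measure _ _ _ (cube_subset_grid ltr01 N0)) _.
have -> : [set v | exists k : {ffun 'I_n -> 'I_N},
    cube (grid_center (1 : R) k) (1 / N%:R) v] =
    \big[setU/set0]_(k : {ffun 'I_n -> 'I_N}) cube (grid_center (1 : R) k) (1 / N%:R).
  apply/seteqP; split => v /=.
    by move=> [k kv]; rewrite (bigD1 k)//=; left.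
  by elim/big_rec: _ => //= k A _ IH [kv|/IH//]; exists k.
have le (r : seq {ffun 'I_n -> 'I_N}) : (hausdorff_content n d
    (\big[setU/set0]_(k <- r) cube (grid_center (1 : R) k) (1 / N%:R)) <=
    ((size r)%:R * (b / N%:R ^+ n))%:E)%E.
  elim: r => [|k r IH]; first by rewrite big_nil outer_measure0 mul0r.
  rewrite big_cons; apply: le_trans (outer_measureU2 _ _ _) _.
  rewrite /= -nat1r mulrDl [1 * (b / _)]mul1r EFinD; apply: leeD => //.
  apply: le_trans (hausdorff_content_diam n s0 Nd _) _ => [x y xk yk|].
    apply: enorm_le_coord => [|i]; first by rewrite divr_ge0 ?(ltW Nr).
    have := xk i; have := yk i; rewrite !mxE !ler_norml.
    by rewrite (mulrC 2) mul1r; lra.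
  rewrite lee_fin /b -[leRHS]mulrA ler_wpM2l ?ball_volume_ge0//.
  rewrite -exprVn -exprMn -[X in X ^+ _]mulrA [2 / _]mulrC.
  by rewrite mulfK.
have := le (enum {ffun 'I_n -> 'I_N}); rewrite big_enum => /le_trans; apply.
rewrite lee_fin -cardT card_ffun !card_ord natrX.
by rewrite mulrC divfK// expf_neq0// gt_eqF.
Qed.

(** The affine law survives the pullback because v |-> c + s v becomes w |-> c J + s w, which is
    s-Lipschitz on the target. *)
Lemma homogeneous_linear_image n p (J : 'M[R]_(n, p)) :
  homogeneous_content (fun A => hausdorff_measure n (linear_image J A)).
Proof.
split.
- by rewrite /linear_image image_set0 hausdorff_measure0.
- by move=> A B AB; apply: le_hausdorff_measure; exact: image_subset.
- by move=> A B; rewrite /linear_image image_setU; exact: hausdorff_measureU.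
- move=> c s A s0.
  apply: (hausdorff_lipschitz (h := fun w => c *m J + s *: w) _ s0).
    move=> _ [_ [v Av <-] <-]; exists (v *m J); first by exists v.
    by rewrite mulmxDl scalemxAl.
  by move=> x y _ _; rewrite opprD addrACA subrr add0r -scalerBr enormZ gtr0_norm.
- have [C C0 CJ] := hausdorff_linear_image_le n J.
  apply: le_lt_trans (CJ _) _; have := hausdorff_cube_lty n.
  by case: hausdorff_measure (hausdorff_measure_ge0 n (cube (0 : 'rV[R]_n) 1))
     => // r _ _; rewrite -EFinM ltry.
Qed.

Lemma homogeneous_hausdorff n :
  homogeneous_content (@hausdorff_measure R n n).
Proof.
have := homogeneous_linear_image (1%:M : 'M[R]_n).
by under eq_fun do rewrite linear_image1.
Qed.

Lemma inflatable_bounded_cube n : inflatable_bounded (cube (0 : 'rV[R]_n) 1).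
Proof.
split; first by exists 1.
move=> e e0; exists e => // v w v1 wv.
have e1 : 0 < 1 + e by rewrite addr_gt0.
exists ((1 + e)^-1 *: w); last by rewrite scalerA divff ?scale1r// gt_eqF.
move=> i; have := v1 i; have := wv i; rewrite !mxE !subr0 normrM.
rewrite gtr0_norm ?invr_gt0// mulrC ler_pdivrMr// mul1r.
by rewrite !ler_norml; lra.
Qed.

Lemma inflatable_bounded_linear_image n (S : 'M[R]_n) A : S \in unitmx ->
  inflatable_bounded A -> inflatable_bounded (linear_image S A).
Proof.
move=> Su [[r r0 Ar] infA]; split.
  exists (r * mx_sum S + 1); first by rewrite ltr_wpDl// mulr_ge0 ?mx_sum_ge0 ?ltW.
  move=> _ [v /Ar vr <-] i; rewrite [(0 : 'rV_n) _ _]mxE subr0 ler_wpDr//.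
  apply: mulmx_coord_le; first exact: ltW.
  by move=> j; have := vr j; rewrite [(0 : 'rV_n) _ _]mxE subr0.
move=> e e0; have [d d0 dA] := infA e e0.
have B0 : 0 < mx_sum (invmx S) + 1 by rewrite ltr_wpDl ?mx_sum_ge0.
(* Displacements are pulled back by the inverse of [S], which enlarges them at most by
   [mx_sum (invmx S)]; the added 1 keeps the denominator positive. *)
exists (d / (mx_sum (invmx S) + 1)); first by rewrite divr_gt0.
move=> _ w [v Av <-] wv.
have [i|a Aa wE] := dA v (w *m invmx S) Av.
  have -> : (w *m invmx S) 0 i - v 0 i = ((w - v *m S) *m invmx S) 0 i.
    by rewrite mulmxBl mulmxK// !mxE.
  have d1 : 0 <= d / (mx_sum (invmx S) + 1) by rewrite divr_ge0 ?ltW.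
  apply: le_trans (mulmx_coord_le _ d1 _ _) _ => [j|].
    by have := wv j; rewrite !mxE.
  by rewrite mulrAC ler_pdivrMr// ler_wpM2l ?(ltW d0)// lerDl.
exists (a *m S); first by exists a.
by rewrite scalemxAl -wE mulmxKV.
Qed.

Lemma hausdorff_linear_image_cube n p (J : 'M[R]_(n, p)) A :
  inflatable_bounded A ->
  (hausdorff_measure n (cube (0 : 'rV[R]_n) 1)
     * hausdorff_measure n (linear_image J A) =
   hausdorff_measure n (linear_image J (cube (0 : 'rV[R]_n) 1))
     * hausdorff_measure n A)%E.
Proof.
move=> iA; apply/eqP; rewrite eq_le.
have h1 := homogeneous_hausdorff n; have h2 := homogeneous_linear_image J.
rewrite (homogeneous_content_le h1 h2 iA)/=.
have := homogeneous_content_le h2 h1 iA.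
by rewrite muleC [leRHS]muleC.
Qed.

(** The ratio T |-> H^n(Q T) / H^n(Q) is multiplicative because Q T is again bounded and inflatable,
    so a second map scales it by the same ratio as Q. *)
Lemma hausdorff_linear_image n (S : 'M[R]_n) A :
  S \in unitmx -> inflatable_bounded A ->
  hausdorff_measure n (linear_image S A) =
  (`|\det S|%:E * hausdorff_measure n A)%E.
Proof.
move=> Su iA.
have hH := homogeneous_hausdorff n.
pose Q : set 'rV[R]_n := cube 0 1.
pose k := fine (hausdorff_measure n Q).
have kE : hausdorff_measure n Q = k%:E by rewrite fineK// (hc_cube_fin hH).
have k0 : 0 <= k by rewrite fine_ge0// hausdorff_measure_ge0.
(* Positivity of H^n(Q) is not established; were it 0, every bounded set and its linear images would
   be null. *)
have [k00|kn0] := eqVneq k 0.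
  have [[r r0 Ar] _] := iA.
  have A0 : hausdorff_measure n A = 0%E.
    apply/eqP; rewrite eq_le hausdorff_measure_ge0 andbT.
    apply: le_trans (le_hausdorff_measure _ Ar) _.
    by rewrite (hc_cube_scale hH r0) -/Q kE k00 mule0.
  rewrite A0 mule0; apply/eqP; rewrite eq_le hausdorff_measure_ge0 andbT.
  have [C C0 /(_ A)] := hausdorff_linear_image_le n S.
  by rewrite A0 mule0.
have kgt0 : 0 < k by rewrite lt_neqAle eq_sym kn0.
pose q (T : 'M[R]_n) := fine (hausdorff_measure n (linear_image T Q)).
have qE T : hausdorff_measure n (linear_image T Q) = (q T)%:E.
  by rewrite fineK// (hc_cube_fin (homogeneous_linear_image T)).
have qk : q S / k = `|\det S|.
  apply: (@homogeneous_character_det _ n (fun T => q T / k)) Su => [T U Tu Uu|T|s s0].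
  - have := hausdorff_linear_image_cube U
      (inflatable_bounded_linear_image Tu (inflatable_bounded_cube n)).
    rewrite -linear_image_mul -/Q kE !qE -!EFinM => -[] H.
    by apply: (mulfI kn0); rewrite [LHS]mulrA H; field.
  - by rewrite divr_ge0// fine_ge0// hausdorff_measure_ge0.
  - apply: (mulIf kn0); rewrite divfK//; apply: EFin_inj.
    rewrite -qE EFinM -kE -(hc_cube_scale hH s0); congr hausdorff_measure.
    apply/seteqP; split => [_ [v vQ <-] i|v vs].
      have := vQ i; rewrite mul_mx_scalar !mxE !subr0 normrM gtr0_norm// => vi.
      by rewrite ler_piMr// ltW.
    exists (s^-1 *: v); last by rewrite mul_mx_scalar scalerA divff ?gt_eqF// scale1r.
    move=> i; have := vs i; rewrite !mxE !subr0 normrM gtr0_norm ?invr_gt0//.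
    by rewrite mulrC ler_pdivrMr// mul1r.
have := hausdorff_linear_image_cube S iA; rewrite -/Q kE qE -qk => H.
rewrite [q S / k]mulrC EFinM -muleA -H muleA -EFinM mulVf// mul1e//.
Qed.

End linear_images.

(** * The wedge product *)

Section wedge_product.
Context {R : realType}.

Lemma dotE n (x y : 'rV[R]_n) : (dot x y)%:M = x *m y^T.
Proof.
apply/matrixP => i j; rewrite !ord1 !mxE eqxx mulr1n.
by apply: eq_bigr => k _; rewrite mxE.
Qed.

Lemma dot_mulmx n (x y : 'rV[R]_n) : dot x y = (x *m y^T) 0 0.
Proof. by rewrite -dotE mxE eqxx. Qed.

Lemma enorm_row_isometry n p (J : 'M[R]_(n, p)) (v : 'rV[R]_n) :
  J *m J^T = 1%:M -> enorm (v *m J) = enorm v.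
Proof.
move=> JJ; rewrite /enorm !dot_mulmx; congr (Num.sqrt (fun_of_matrix _ 0 0)).
by rewrite trmx_mul mulmxA -[v *m J *m _]mulmxA JJ mulmx1.
Qed.

(** Both sides are linear in [u] with the first-row cofactors as coefficients; these do not see the
    first row, so [c] is computed with 0 there. *)
Lemma dot_wedge m (P : 'I_m -> 'rV[R]_m.+1) (u : 'rV[R]_m.+1) :
  dot u (wedge P) = \det (col_mx u (\matrix_(j < m) P j) : 'M[R]_(1 + m)).
Proof.
set J := \matrix_(j < m) P j.
pose c j := cofactor (col_mx (0 : 'rV[R]_m.+1) J : 'M[R]_(1 + m)) 0 j.
have detE v : \det (col_mx v J : 'M[R]_(1 + m)) = \sum_j v 0 j * c j.
  rewrite (expand_det_row _ 0); apply: eq_bigr => j _; congr (_ * _).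
    have z : 0 = lshift m 0 :> 'I_(1 + m) by apply/val_inj.
    by rewrite z; exact: (col_mxEu v J).
  rewrite /c /cofactor; congr (_ * _); congr (\det _); apply/matrixP => k l; rewrite !mxE.
  by case: splitP => // i; rewrite ord1.
rewrite detE; apply: eq_bigr => j _; congr (_ * _).
rewrite /wedge summxE (bigD1 j)//= big1 ?addr0 => [|i ij].
  rewrite !mxE !eqxx mulr1 det_tr detE (bigD1 j)//= big1 ?addr0 => [|i ij].
    by rewrite !mxE !eqxx mul1r.
  by rewrite !mxE (negbTE ij) andbF mul0r.
by rewrite !mxE eq_sym (negbTE ij) andbF mulr0.
Qed.

(** By [dot_wedge], orthogonality is the vanishing of a determinant, hence a drop of rank, which for
    independent P_j puts [u] in their span. *)
Lemma wedge_orthogonal m (P : 'I_m -> 'rV[R]_m.+1) (u : 'rV[R]_m.+1) :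
  row_free (\matrix_(j < m) P j) ->
  (dot u (wedge P) == 0) = (u <= \matrix_(j < m) P j)%MS.
Proof.
rewrite dot_wedge; set J := \matrix_(j < m) P j => Jfree.
set M : 'M[R]_(1 + m) := col_mx u J.
have rM : \rank M = \rank (u + J)%MS by rewrite addsmxE.
have MuE : (\det M == 0) = (\rank (u + J)%MS < m.+1)%N.
  rewrite -[\det M == 0]negbK -unitfE -unitmxE -row_free_unit /row_free rM.
  by rewrite ltn_neqAle rank_leq_col andbT.
rewrite MuE; apply/idP/idP => [lt|uJ].
  apply: contraLR lt => nuJ; rewrite -leqNgt -[m in (m < _)%N](eqP Jfree).
  apply: rank_ltmx; rewrite /ltmx addsmxSr/=.
  by apply: contra nuJ => /(submx_trans (addsmxSl u J)).
rewrite ltnS -[leqRHS](eqP Jfree); apply: mxrankS.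
by rewrite addsmx_sub uJ submx_refl.
Qed.

(** Were the wedge zero, every vector would be orthogonal to it, and m rows would span a space of
    dimension m + 1. *)
Lemma wedge_neq0 m (P : 'I_m -> 'rV[R]_m.+1) :
  row_free (\matrix_(j < m) P j) -> wedge P != 0.
Proof.
move=> Jfree; apply/eqP => P0.
have : (1%:M <= \matrix_(j < m) P j)%MS.
  apply/row_subP => i; rewrite -wedge_orthogonal// P0.
  by rewrite /dot big1// => k _; rewrite [X in _ * X]mxE mulr0.
by move=> /mxrankS; rewrite mxrank1 leqNgt ltnS rank_leq_row.
Qed.

Lemma enorm_eq0 n (x : 'rV[R]_n) : enorm x = 0 -> x = 0.
Proof.
move=> x0; apply/rowP => i; rewrite mxE; apply/eqP.
by rewrite -normr_le0 -x0 coord_le_enorm.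
Qed.

(** The Householder reflection along Z - |Z| e_i, or the identity when that vector vanishes. *)
Lemma reflection_to_axis n (Z : 'rV[R]_n) (i : 'I_n) :
  exists2 O : 'M[R]_n, O *m O^T = 1%:M & Z *m O = enorm Z *: evec R i.
Proof.
have [w wE] : exists w, w = Z - enorm Z *: evec R i by eexists.
have [w0|w0] := eqVneq w 0.
  exists 1%:M; first by rewrite tr_scalar_mx mulmx1.
  by rewrite mulmx1; apply/eqP; rewrite -subr_eq0 -wE w0.
pose d := dot w w; pose k := 2 / d.
have d0 : d != 0.
  by apply: contra w0 => /eqP d0; rewrite (@enorm_eq0 _ w)// /enorm -/d d0 sqrtr0.
have wwT : w *m w^T = d%:M by rewrite dotE.
pose O : 'M[R]_n := 1%:M - k *: (w^T *m w).
have OT : O^T = O.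
  by rewrite /O linearB/= tr_scalar_mx linearZ/= trmx_mul trmxK.
exists O.
  rewrite OT /O mulmxBl mul1mx mulmxBr mulmx1.
  rewrite -scalemxAl -scalemxAr mulmxA -[_ *m w *m w^T]mulmxA wwT.
  rewrite mul_mx_scalar -scalemxAl !scalerA -addrA -opprD -[RHS]subr0.
  congr (_ - _); apply/eqP; rewrite addrA subr_eq0 -scalerDl; apply/eqP.
  congr (_ *: _); rewrite /k; field; exact: d0.
have ev : dot (evec R i) (evec R i) = 1.
  rewrite /dot (bigD1 i)//= big1 ?addr0 => [|j ji]; rewrite !mxE ?eqxx ?mulr1//.
  by rewrite (negbTE ji) andbF mul0r.
have dZe : dot Z (evec R i) = Z 0 i.
  rewrite /dot (bigD1 i)//= big1 ?addr0 => [|j ji]; rewrite !mxE ?eqxx ?mulr1//.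
  by rewrite (negbTE ji) andbF mulr0.
(* Z and |Z| e_i have equal length, so |w|^2 is twice Z . w. *)
have Zw : dot Z w = d / 2.
  have dD x y t : dot (x - t *: y) (x - t *: y) =
      dot x x - 2 * t * dot x y + t ^+ 2 * dot y y :> R.
    rewrite /dot !mulr_sumr -sumrB -big_split/=; apply: eq_bigr => j _.
    by rewrite !mxE; ring.
  have dB x y t : dot x (x - t *: y) = dot x x - t * dot x y :> R.
    rewrite /dot !mulr_sumr -sumrB; apply: eq_bigr => j _.
    by rewrite !mxE; ring.
  by rewrite /d wE dD dB ev -enorm_sqr; field.
rewrite /O mulmxBr mulmx1 -scalemxAr mulmxA -dotE Zw mul_scalar_mx scalerA.
have -> : k * (d / 2) = 1 by rewrite /k; field; exact: d0.
by rewrite scale1r wE opprB addrC subrK.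
Qed.

(** Once Z lies on the first axis, the rows of [J] lie in the complementary coordinate hyperplane,
    so [J *m Q] is a square matrix [S] followed by an isometric embedding. *)
Lemma hausdorff_wedge m (P : 'I_m -> 'rV[R]_m.+1) A :
  row_free (\matrix_(j < m) P j) -> inflatable_bounded A ->
  hausdorff_measure m (linear_image (\matrix_(j < m) P j) A) =
  ((enorm (wedge P))%:E * hausdorff_measure m A)%E.
Proof.
move=> Jfree iA; set J := \matrix_(j < m) P j in Jfree *; set Z := wedge P.
have Z0 : Z != 0 by exact: wedge_neq0.
have nZ0 : enorm Z != 0 by apply: contra Z0 => /eqP/enorm_eq0 ->.
have [Q QQ ZQ] := reflection_to_axis Z 0.
have detQ : `|\det Q| = 1.
  have /(congr1 determinant) := QQ; rewrite det_mulmx det_tr det1 -expr2 => detQ2.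
  by apply/eqP; rewrite -(@eqrXn2 _ 2)// -normrX detQ2 normr1 expr1n.
have JZ : J *m Z^T = 0.
  apply/row_matrixP => j; rewrite row_mul row0 -dotE; apply/matrixP => a b.
  rewrite !mxE !ord1 eqxx mulr1n; apply/eqP.
  by rewrite wedge_orthogonal// row_sub.
pose JQ : 'M[R]_(m, 1 + m) := J *m Q; pose S := rsubmx JQ.
have JQ0 : lsubmx JQ = 0.
  apply/matrixP => j l; rewrite !ord1 mxE [RHS]mxE.
  have : JQ *m (Z *m Q)^T = 0.
    by rewrite /JQ trmx_mul mulmxA -[J *m Q *m _]mulmxA QQ mulmx1 JZ.
  move=> /matrixP/(_ j 0); rewrite ZQ [RHS]mxE.
  rewrite linearZ/= -scalemxAr [LHS]mxE => /eqP; rewrite mulf_eq0 (negbTE nZ0)/=.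
  rewrite /evec trmx_delta -colE mxE => /eqP <-; congr (JQ _ _); exact/val_inj.
have JQE : JQ = S *m row_mx 0 1%:M.
  by rewrite mul_mx_row mulmx0 mulmx1 -JQ0 hsubmxK.
(* The determinant with rows Z and [J] is |Z|^2; multiplied by [Q] it becomes |Z| det S. *)
have dS : `|\det S| = enorm Z.
  pose M : 'M[R]_(1 + m) := col_mx Z J.
  have dM : \det M = enorm Z ^+ 2 by rewrite enorm_sqr dot_wedge.
  have MQ : M *m (Q : 'M[R]_(1 + m)) = block_mx (enorm Z)%:M 0 0 S.
    rewrite [LHS]mul_col_mx -/JQ -[JQ]hsubmxK JQ0 -/S ZQ block_mxEv.
    congr (col_mx _ _); apply/rowP => j; rewrite !mxE.
    case: splitP => l jl; rewrite !mxE.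
      have -> : j = 0 by apply/val_inj; rewrite /= jl ord1.
      by rewrite !ord1 !eqxx mulr1n mulr1.
    have -> : (j == 0) = false by apply/negP => /eqP j0; move: jl; rewrite j0.
    by rewrite andbF mulr0.
  have := congr1 (fun M => `|\det M|) MQ.
  rewrite det_mulmx normrM detQ mulr1 dM det_ublock det_scalar1 normrX normrM.
  by rewrite ger0_norm ?enorm_ge0// expr2 => /(mulfI nZ0).
have Su : S \in unitmx by rewrite unitmxE unitfE -normr_eq0 dS.
rewrite -dS -(hausdorff_linear_image Su iA).
rewrite -(@hausdorff_isometry _ _ _ _ Q) => [|v]; last exact: enorm_row_isometry.
rewrite -linear_image_mul -/JQ JQE linear_image_mul.
apply: hausdorff_isometry => v; apply: enorm_row_isometry.
pose J1 : 'M[R]_(m, 1 + m) := row_mx 0 1%:M.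
rewrite -[LHS]/(J1 *m J1^T) tr_row_mx mul_row_col.
by rewrite trmx0 mulmx0 add0r tr_scalar_mx mulmx1.
Qed.

End wedge_product.

(** * Gauges *)

Section gauges.
Context {R : realType}.

Lemma coord_le_norm n (v : 'rV[R]_n) i : `|v 0 i| <= `|v|.
Proof.
by rewrite [X in _ <= X]mx_normrE (le_bigmax _ (fun ij => `|v ij.1 ij.2|) (0, i)).
Qed.

Lemma norm_le_coord n (v : 'rV[R]_n) r :
  0 <= r -> (forall i, `|v 0 i| <= r) -> `|v| <= r.
Proof.
move=> r0 vr; rewrite [X in X <= _]mx_normrE; apply: bigmax_le => // -[i j] _ /=.
by rewrite ord1.
Qed.

Lemma norm_ball_compact n (r : R) : compact [set v : 'rV[R]_n | `|v| <= r].
Proof.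
apply: (subclosed_compact _ (rV_compact (fun _ : 'I_n => @segment_compact _ (- r) r))).
  by apply: preimage_closed (@closed_le _ r) => v _; exact: norm_continuous.
move=> v /= vr i; rewrite /= in_itv/= -ler_norml.
exact: le_trans (coord_le_norm _ _) vr.
Qed.

Lemma norm_sphere_compact n : compact [set v : 'rV[R]_n | `|v| = 1].
Proof.
apply: (subclosed_compact _ (@norm_ball_compact n 1)); last by move=> v /= ->.
by apply: preimage_closed (@closed_eq _ 1) => v _; exact: norm_continuous.
Qed.

(** Compactness of the sphere makes f comparable to the norm, hence continuous at 0 with bounded
    sublevel set. Uniform continuity on a ball containing that set gives f w < 1 + e for w near it,
    and homogeneity puts w / (1 + e) back in the set. *)
Lemma gauge_inflatable_bounded n (f : 'rV[R]_n -> R) :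
  f 0 = 0 -> (forall v t, 0 < t -> f (t *: v) = t * f v) ->
  (forall v, v != 0 -> 0 < f v) ->
  (forall v, v != 0 -> {for v, continuous f}) ->
  inflatable_bounded [set v | f v <= 1].
Proof.
move=> f0 fZ fpos fcont.
have [a a0 fa] : exists2 a : R, 0 < a & forall v, `|v| = 1 -> a < f v < a^-1.
  (* The near-covering form of compactness lets one small [a] serve all points of the sphere. *)
  have cover := (compact_near_coveringP _).1 (@norm_sphere_compact n).
  have H : \forall a \near (0 : R)^'+,
      [set v : 'rV[R]_n | `|v| = 1] `<=` (fun v => a < f v < a^-1).
    apply: cover => v /= v1.
    have v0 : v != 0 by rewrite -normr_gt0 v1.
    have fv0 := fpos _ v0.
    near=> w i => /=; apply/andP; split.
      apply: (@lt_trans _ _ (f v / 2)); first by near: i; apply: nbhs_right_lt; rewrite divr_gt0.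
      by near: w; apply: (cvgr_gt (f v)); [exact: fcont|lra].
    apply: (@lt_trans _ _ (f v * 2)).
      by near: w; apply: (cvgr_lt (f v)); [exact: fcont|lra].
    have i0 : 0 < i by near: i; exact: nbhs_right_gt.
    rewrite -[ltLHS]invrK ltf_pV2 ?posrE ?invr_gt0 ?mulr_gt0//.
    by near: i; apply: nbhs_right_lt; rewrite invr_gt0 mulr_gt0.
  near (0 : R)^'+ => a; exists a; first by near: a; exact: nbhs_right_gt.
  by near: a; exact: H.
have fnorm v : v != 0 -> a * `|v| < f v < a^-1 * `|v|.
  move=> v0; have nv : 0 < `|v| by rewrite normr_gt0.
  have /fa : `|(`|v|^-1 *: v)| = 1.
    by rewrite normrZ normfV normr_id mulVf// gt_eqF.
  by rewrite fZ ?invr_gt0// mulrC ltr_pdivlMr// ltr_pdivrMr.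
have f_cont : continuous f.
  move=> v; have [->|v0] := eqVneq v 0; last exact: fcont.
  apply/(@cvgrPdist_lt _ _ _ (nbhs (0 : 'rV[R]_n)) (nbhs_filter _)) => e e0; rewrite f0.
  have : \forall w \near (0 : 'rV[R]_n), `|w| < e * a.
    have /cvgr_lt := @norm_continuous R 'rV[R]_n 0; apply.
    by rewrite normr0 mulr_gt0.
  apply: filterS => w wea; rewrite sub0r normrN.
  have [->|w0] := eqVneq w 0; first by rewrite f0 normr0.
  have /andP[_ fw] := fnorm _ w0; rewrite gtr0_norm ?fpos//.
  apply: lt_trans fw _; rewrite mulrC ltr_pdivrMr//.
have fge0 v : 0 <= f v.
  by have [->|/fpos/ltW//] := eqVneq v 0; rewrite f0.
have bound v : f v <= 1 -> `|v| <= a^-1.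
  move=> fv1; have [->|v0] := eqVneq v 0; first by rewrite normr0 invr_ge0 ltW.
  have /andP[fv _] := fnorm _ v0.
  by rewrite -[a^-1]mulr1 mulrC ler_pdivlMr// mulrC (le_trans (ltW fv)).
split.
  exists a^-1; first by rewrite invr_gt0.
  move=> v /bound va i; rewrite mxE subr0; exact: le_trans (coord_le_norm _ _) va.
move=> e e0.
have [d d0 fd] : exists2 d : R, 0 < d & forall v w, f v <= 1 -> `|w - v| < d -> f w < f v + e.
  have cover := (compact_near_coveringP _).1 (@norm_ball_compact n a^-1).
  have H : \forall d \near (0 : R)^'+, [set v : 'rV[R]_n | `|v| <= a^-1] `<=`
      (fun v => forall w, `|w - v| < d -> f w < f v + e).
    apply: cover => v _.
    have [r /= r0 vr] : exists2 r : R, 0 < r & forall w, `|w - v| < r -> `|f v - f w| < e / 2.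
      have /cvgrPdist_lt/(_ (e / 2)) := f_cont v.
      rewrite divr_gt0// => /(_ isT) /nbhs_ballP[r /= r0 vr]; exists r => // w wv.
      by apply: vr; rewrite -ball_normE/= distrC.
    near=> v' d => /= w wv'.
    have v'v : `|v' - v| < r / 2.
      near: v'; have /cvgr_distC_lt := @cvg_id _ (nbhs v).
      by apply; rewrite divr_gt0.
    have dr : d < r / 2 by near: d; apply: nbhs_right_lt; rewrite divr_gt0.
    have wv : `|w - v| < r.
      rewrite -(subrK v' w) -addrA (le_lt_trans (ler_normD _ _))//.
      by lra.
    have := vr _ wv; have v'r : `|v' - v| < r by lra.
    by have := vr _ v'r; rewrite !ltr_norml; lra.
  near (0 : R)^'+ => d; exists d; first by near: d; exact: nbhs_right_gt.
  suff K v : `|v| <= a^-1 -> forall w, `|w - v| < d -> f w < f v + e.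
    by move=> v w /bound va; exact: K.
  by move: v; near: d; exact: H.
(* Halving turns the non-strict coordinate bounds into the strict norm bound of [fd]. *)
exists (d / 2) => [|v w fv1 wv]; first by rewrite divr_gt0.
have e1 : 0 < 1 + e by rewrite addr_gt0.
exists ((1 + e)^-1 *: w); last by rewrite scalerA divff ?scale1r// gt_eqF.
rewrite /= fZ ?invr_gt0// mulrC ler_pdivrMr// mul1r.
have : `|w - v| < d.
  apply: (@le_lt_trans _ _ (d / 2)); last by lra.
  by apply: norm_le_coord => [|i]; [rewrite divr_ge0 ?ltW|rewrite !mxE].
by move=> /(fd _ _ fv1); move: (fv1 : f v <= 1); lra.
Unshelve. all: by end_near. Qed.
End gauges.

(** * Finsler metrics *)

(** Includes a = 0 and a = +oo, with the conventional inverses +oo and 0, so the measure of B may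
    take any value in [0, +oo]. *)
Lemma divee_pmul2l {R : realType} (z : R) (h a : \bar R) : 0 < z -> (0 <= a)%E ->
  (z%:E * h / (z%:E * a) = h / a)%E.
Proof.
move=> z0 a0; have zn0 : z != 0 by rewrite gt_eqF.
have -> : ((z%:E * a)^-1 = z^-1%:E * a^-1)%E.
  case: a a0 => [r _| _ |//].
    rewrite -EFinM !inver mulf_eq0 (negbTE zn0)/=.
    have [_|r0] := eqVneq r 0; first by rewrite gt0_muley// lte_fin invr_gt0.
    by rewrite invfM EFinM.
  by rewrite gt0_muley ?lte_fin// invey mule0.
by rewrite muleACA -EFinM divff// mul1e.
Qed.

Lemma linear_row_sum {R : realType} {n : nat} {V : lmodType R}
    (L : {linear 'rV[R]_n -> V}) (v : 'rV[R]_n) :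
  L v = \sum_i v 0 i *: L (evec R i).
Proof.
rewrite {1}(row_sum_delta v) linear_sum.
by apply: eq_bigr => i _; rewrite linearZ.
Qed.

Section finsler.
Context {R : realType} {n : nat} {F : 'rV[R]_n -> 'rV[R]_n -> R}.
Hypothesis HF : finsler_metric F.

Let G (p : 'rV[R]_n * 'rV[R]_n) : R^o := F p.1 p.2.

Lemma differentiable_pairr (W : normedModType R)
    (H : 'rV[R]_n * 'rV[R]_n -> W) x y :
  differentiable H (x, y) -> differentiable (fun z => H (x, z)) y.
Proof.
by move=> dH; apply: (@differentiable_comp _ _ _ _ (fun z => (x, z)) H).
Qed.

Lemma finsler_differentiable x y : y != 0 -> differentiable (F x : _ -> R^o) y.
Proof.
move=> y0; apply: (differentiable_pairr (H := G)).
by have [dG _] := finsler_smooth HF 1; exact: dG.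
Qed.

(** Smoothness is assumed jointly in (x, y); this expresses derivatives in y alone through the joint
    function. *)
Lemma derive_pairr x v y : 'D_v (F x : _ -> R^o) y = 'D_(0, v) G (x, y).
Proof.
rewrite /derive; set f := (X in lim (X @ _) = _); set g := (X in _ = lim (X @ _)).
suff -> : f = g by [].
by apply/funext => h; rewrite /f /g /G /= scaler0 add0r.
Qed.

Lemma finsler_derive_differentiable x v y :
  y != 0 -> differentiable (fun z => 'D_v (F x : _ -> R^o) z) y.
Proof.
move=> y0; under eq_fun do rewrite derive_pairr.
apply: (differentiable_pairr (H := fun p => 'D_(0, v) G p)).
by have [_ /(_ (0, v))[dG _]] := finsler_smooth HF 2; exact: dG.
Qed.

Lemma derive_half_square x v y : y != 0 ->
  'D_v (fun z => F x z ^+ 2 / 2 : R^o) y = F x y * 'D_v (F x : _ -> R^o) y.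
Proof.
move=> y0; have dF : derivable (F x : _ -> R^o) y v.
  by apply: diff_derivable; exact: finsler_differentiable.
have -> : (fun z => F x z ^+ 2 / 2 : R^o) = 2^-1 \*: ((F x : _ -> R^o) ^+ 2).
  by apply/funext => z; rewrite /= mulrC -[RHS]/(_ * _).
rewrite deriveZ; last exact: derivableX.
rewrite deriveX// expr1 -[LHS]/(_ * _) -[_ *: _]/(_ * _).
by rewrite !mulrA mulVf ?mul1r// pnatr_eq0.
Qed.

(** The definition grants only F >= 0. A zero of F off the origin would spread along its ray and
    make the Hessian of F^2 / 2 degenerate there, against (F2). *)
Lemma finsler_gt0 x y : y != 0 -> 0 < F x y.
Proof.
move=> y0; rewrite lt_neqAle finsler_ge0// andbT eq_sym.
apply/eqP => Fy0.
pose k i (z : 'rV[R]_n) : R^o := F x z * 'D_(evec R i) (F x : _ -> R^o) z.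
have dk i : differentiable (k i) y.
  apply: differentiableM; first exact: finsler_differentiable.
  exact: finsler_derive_differentiable.
(* [k i] vanishes on the ray through [y], so the Hessian is null at [y, y]. *)
have Dk i : 'D_y (k i) y = 0.
  apply: cvg_lim => //; apply: cvg_near_cst.
  (* For h > -1 the point h y + y stays on the open ray through [y], where homogeneity applies. *)
  have : \forall h \near (0 : R)^', -1 < h.
    by apply: nbhs_dnbhs; apply: lt_nbhsr; rewrite oppr_lt0.
  apply: filterS => h h1 /=; rewrite /k.
  have -> : h *: y + y = (h + 1) *: y by rewrite scalerDl scale1r.
  by rewrite (finsler_homogeneous HF) ?Fy0 ?mulr0 ?mul0r ?subrr ?scaler0//; lra.
have := finsler_posdef HF x y0 y0.
rewrite big1 ?ltxx// => i _.
(* Near [y] the inner derivative is [k i], so row i of the Hessian contracted with [y] is the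
   derivative of [k i] along [y]. *)
under eq_bigr => j _.
  rewrite mulrAC.
  have -> : 'D_(evec R j)
      (fun z => 'D_(evec R i) (fun z' => F x z' ^+ 2 / 2 : R^o) z) y
      = 'd (k i) y (evec R j).
    rewrite -deriveE//; apply: near_eq_derive.
    have : \forall z \near y, z != 0.
      have /cvgr_gt/(_ 0) := @norm_continuous R 'rV[R]_n y.
      rewrite normr_gt0 => /(_ y0); apply: filterS => z.
      by rewrite normr_gt0.
    by apply: filterS => z z0; exact: derive_half_square.
  over.
rewrite -mulr_suml.
have -> : \sum_j 'd (k i) y (evec R j) * y 0 j = 'd (k i) y y.
  rewrite (linear_row_sum ('d (k i) y : {linear 'rV[R]_n -> R^o})).
  by apply: eq_bigr => j _; rewrite mulrC.
by rewrite -deriveE// Dk mul0r.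
Qed.

Lemma finsler_inflatable_bounded m (L : {linear 'rV[R]_m -> 'rV[R]_n}) x :
  continuous L -> injective L -> inflatable_bounded [set v | F x (L v) <= 1].
Proof.
move=> Lc Li.
have L0 v : v != 0 -> L v != 0.
  by apply: contra => /eqP; rewrite -(linear0 L) => /Li ->.
apply: gauge_inflatable_bounded => [|v t t0|v v0|v v0].
- by rewrite linear0 finsler_at0.
- by rewrite linearZ (finsler_homogeneous HF).
- by apply: finsler_gt0; exact: L0.
- apply: continuous_comp; first exact: Lc.
  by apply: differentiable_continuous; exact: finsler_differentiable (L0 _ v0).
Qed.

End finsler.

(** * Equality of the two area integrands *)

Theorem theorem1p1 (R : realType) (m : nat)
    (F : 'rV[R]_m.+1 -> 'rV[R]_m.+1 -> R) (HF : finsler_metric F)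
    (M : topologicalType) (A : set (chart R M m)) (HA : smooth_manifold A)
    (X : M -> 'rV[R]_m.+1) (HX : C1_immersion A X)
    (c : chart R M m) (Hc : A c) :
  finsler_area F X c =
  lebesgue_int (chart_cod c)
    (fun u => finsler_integrand F (X (chart_inv c u))
                (wedge (partial_derivative c X u))).
Proof.
apply: eq_integral => u /set_mem cu.
have [dX injX] := HX c Hc.
pose phi := X \o chart_inv c; pose p := chart_inv c u.
have [cp pu] : chart_dom c p /\ chart_map c p = u.
  have [q cq qu] := cu.
  by rewrite /p -qu (chart_mapK (atlas_charts HA Hc) cq).
have dphi : differentiable phi u by case: dX => + _; exact.
pose L : {linear 'rV[R]_m -> 'rV[R]_m.+1} := 'd phi u.
have Lc : continuous L by exact: diff_continuous.
have Li : injective L by have := injX p cp; rewrite /tangent_map pu.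
set P := partial_derivative c X u; pose J := \matrix_(j < m) P j.
have LE v : L v = v *m J.
  rewrite mulmx_sum_row linear_row_sum.
  by apply: eq_bigr => j _; rewrite rowK /P /partial_derivative deriveE.
have Jfree : row_free J.
  apply: inj_row_free => v; rewrite -LE -(linear0 L); exact: Li.
pose B := [set v | F (X p) (L v) <= 1].
have iB : inflatable_bounded B by exact: finsler_inflatable_bounded.
(* The hyperplane orthogonal to the wedge is the row space of [J], that is the range of dX, so the
   set in A^F is parametrized by [B]. *)
have ZB : orthogonal_space (wedge P) `&` [set T | F (X p) T <= 1] = linear_image J B.
  apply/seteqP; split => [T [/eqP]|_ [v Bv <-]].
    rewrite wedge_orthogonal// => /submxP[v ->] /= FT.
    by exists v => //; rewrite /B /= LE.
  split; last by move: Bv; rewrite /B /= LE.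
  by apply/eqP; rewrite wedge_orthogonal// submxMl.
rewrite /finsler_density /finsler_integrand -/p ZB hausdorff_wedge//.
have Z0 : 0 < enorm (wedge P).
  rewrite lt_neqAle enorm_ge0 andbT eq_sym.
  by apply: contra (wedge_neq0 Jfree) => /eqP/enorm_eq0 ->.
rewrite (divee_pmul2l _ Z0 (hausdorff_measure_ge0 m B)).
by rewrite /pullback_metric /tangent_map pu.
Qed.
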